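(* Let $p$ be a positive integer and let $h\in(0,+\infty)$ be a real number. There exist strongly connected oriented graphs $G$ and $G'$ (each with a finite or countable set of vertices), both of period $p$, such that $h(G)=h(G')=h$ (Gurevich entropy), $G$ is positive recurrent and $G'$ is transient.
   Context: All graphs are oriented, have a finite or countable set of vertices, and for any two vertices $u,v$ (possibly equal) there is at most one arrow $u\to v$. A path of length $n$ in $G$ is a sequence of vertices $(u_0,\dots,u_n)$ with $u_i\to u_{i+1}$ in $G$ for all $0\le i\le n-1$. For vertices $u,v$ of $G$: - $p_{uv}^G(n)$ is the number of paths $(u_0,\dots,u_n)$ with $u_0=u$, $u_n=v$, and $R_{uv}(G)$ is the radius of convergence of $\sum_n p_{uv}^G(n)z^n$; - for $n\ge 1$, $f_{uv}^G(n)$ is the number of paths $(u_0,\dots,u_n)$ with $u_0=u$, $u_n=v$ and $u_i\neq v$ for all $0<i<n$. $G$ is strongly connected if for all vertices $u,v$ there is a path from $u$ to $v$. In that case $R_{uv}(G)$ does not depend on $u,v$ (Vere-Jones) and is denoted $R(G)$, or $R$. The period of a strongly connected graph $G$ is the greatest common divisor of all $n\ge1$ such that $p_{uu}^G(n)>0$ for some vertex $u$. Classification (Vere-Jones) of a strongly connected graph $G$, with $R=R(G)$ and $u$ a vertex (the classification does not depend on $u$): $G$ is transient if $\sum_{n\ge1} f_{uu}^G(n)R^n<1$; $G$ is null recurrent if $\sum_{n\ge1} f_{uu}^G(n)R^n=1$ and $\sum_{n\ge1} n f_{uu}^G(n)R^n=+\infty$; $G$ is positive recurrent if $\sum_{n\ge1}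 f_{uu}^G(n)R^n=1$ and $\sum_{n\ge1} n f_{uu}^G(n)R^n<+\infty$. Gurevich entropy: for a graph $H$ with vertex set $V$, $\Gamma_H=\{(v_n)_{n\in\mathbb{Z}}\in V^{\mathbb{Z}} : v_n\to v_{n+1}\text{ in }H\text{ for all }n\in\mathbb{Z}\}$, with the topology induced by the product of discrete topologies, and $\sigma$ is the shift on $\Gamma_H$. Then $h(G)=\sup\{h_{top}(\Gamma_H,\sigma): H\subset G,\ H\text{ finite subgraph}\}$, where $h_{top}$ is topological entropy. For strongly connected $G$ it is known (Gurevich) that $h(G)=-\log R(G)$. *)

(* Defs.v *)
From HB Require Import structures.
From mathcomp Require Import all_boot all_order all_algebra.
From mathcomp Require Import finmap.
From mathcomp Require Import all_classical all_reals all_analysis.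

Set Implicit Arguments.
Unset Strict Implicit.
Unset Printing Implicit Defensive.

Import Order.TTheory GRing.Theory Num.Theory.

Local Open Scope classical_set_scope.
Local Open Scope ring_scope.
Local Open Scope ereal_scope.

Record graph := Graph { vertex :> countType ; arrow : rel vertex }.

Definition paths (G : graph) (u v : G) (n : nat) : set (n.+1.-tuple G) :=
  [set w : n.+1.-tuple G |
    [/\ tnth w ord0 = u, tnth w ord_max = v & sorted (@arrow G) w]].

Arguments paths {G} u v n _.

Definition first_paths (G : graph) (u v : G) (n : nat) : set (n.+1.-tuple G) :=
  paths u v n `&`
  [set w : n.+1.-tuple G |
     forall i : 'I_n.+1, (0 < i < n)%N -> tnth w i <> v].

Arguments first_paths {G} u v n _.

(* The counts are extended reals because, in a graph that is not locally
   finite, there may be infinitely many paths of a given length. *)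
Definition npaths (R : realType) (G : graph) (u v : G) (n : nat) : \bar R :=
  counting (paths u v n).

Definition nfirst_paths (R : realType) (G : graph) (u v : G) (n : nat) :
  \bar R := counting (first_paths u v n).

(* Radius of convergence of the power series with coefficients
   [npaths R u v n]. As these are nonnegative, it is the supremum of the
   r >= 0 at which the series converges. *)
Definition convergence_radius (R : realType) (G : graph) (u v : G) : \bar R :=
  ereal_sup [set r%:E | r in [set r : R | (0 <= r)%R /\
    \sum_(0 <= n <oo) npaths R u v n * (r ^+ n)%:E < +oo]].

Definition strongly_connected (G : graph) : Prop :=
  forall u v : G, exists n, paths u v n !=set0.

Definition return_times (G : graph) : set nat :=
  [set n | (0 < n)%N /\ exists u : G, paths u u n !=set0].

(* [p] is the gcd of the set [return_times G] (0 if this set is empty). *)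
Definition has_period (G : graph) (p : nat) : Prop :=
  (forall n, return_times G n -> (p %| n)%N) /\
  (forall d, (forall n, return_times G n -> (d %| n)%N) -> (d %| p)%N).

(* In the classification below, G is meant to be strongly connected. Then
   [convergence_radius R u u] is the common value R(G) of all the radii, and
   the conditions do not depend on the vertex u. *)
Definition transient (R : realType) (G : graph) : Prop :=
  forall u : G,
    \sum_(1 <= n <oo) nfirst_paths R u u n * convergence_radius R u u ^+ n < 1.

Definition positive_recurrent (R : realType) (G : graph) : Prop :=
  forall u : G,
    \sum_(1 <= n <oo)
      nfirst_paths R u u n * convergence_radius R u u ^+ n = 1 /\
    \sum_(1 <= n <oo)
      n%:R%:E * nfirst_paths R u u n * convergence_radius R u u ^+ n < +oo.

(* Topological entropy of f : X -> X, following Adler, Konheim and McAndrew. *)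

Definition open_covers (X : topologicalType) : set (set (set X)) :=
  [set U | U `<=` open /\ \bigcup_(A in U) A = setT].

Arguments open_covers : clear implicits.

(* Minimal cardinality of a subcover of U (+oo if none is finite). *)
Definition subcover_number (R : realType) (X : topologicalType)
    (U : set (set X)) : \bar R :=
  ereal_inf [set counting V |
    V in [set V : set (set X) | V `<=` U /\ \bigcup_(A in V) A = setT]].

(* U \/ f^-1 U \/ ... \/ f^-(n-1) U *)
Definition iterated_join (X : topologicalType) (f : X -> X)
    (U : set (set X)) (n : nat) : set (set X) :=
  [set \bigcap_(i in `I_n) (iter i f @^-1` A i) |
    A in [set A : nat -> set X | forall i, (i < n)%N -> U (A i)]].

(* For X compact and f continuous the sequence converges (subadditivity), and
   the limsup is its limit. As lne 0 = -oo, the empty space gets entropy -oo. *)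
Definition cover_entropy (R : realType) (X : topologicalType) (f : X -> X)
    (U : set (set X)) : \bar R :=
  limn_esup (fun n : nat =>
    (n%:R^-1)%:E * lne (subcover_number R (iterated_join f U n))).

Definition topological_entropy (R : realType) (X : topologicalType)
    (f : X -> X) : \bar R :=
  ereal_sup [set cover_entropy R f U | U in open_covers X].

Definition bi_paths (H : graph) :
    set ({ptws int -> discrete_topology H}) :=
  [set x | forall k : int, arrow (x k : H) (x (k + 1)%R)].

Arguments bi_paths : clear implicits.

(* [set_type] carries the topology induced by the product topology. *)
Definition markov_space (H : graph) : topologicalType := set_type (bi_paths H).

Lemma shift_bi_paths (H : graph) (x : markov_space H) :
  ((fun k : int => set_val x (k + 1)%R)
     : {ptws int -> discrete_topology H}) \in bi_paths H.
Proof. by apply/mem_set => k; exact: (set_valP x (k + 1)%R). Qed.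

Definition markov_shift (H : graph) (x : markov_space H) : markov_space H :=
  SigSub (shift_bi_paths x).

(* A finite subgraph consists of a finite set W of vertices of G and of some of
   the arrows of G between elements of W. *)
Definition gurevich_entropy (R : realType) (G : graph) : \bar R :=
  ereal_sup [set e | exists (W : {fset G}) (E : rel W),
    (forall x y : W, E x y -> arrow (val x) (val y)) /\
    e = topological_entropy R (@markov_shift (Graph E))].

(* Main.v *)
Require Import Defs.
From mathcomp Require Import all_boot all_order all_algebra.
From mathcomp Require Import finmap.
From mathcomp Require Import all_classical all_reals all_analysis.
From mathcomp Require Import lra zify ring.

(** Both graphs are bouquets of loops: vertices on countably many disjoint
    simple loops that share one base vertex. Let F(z) be the sum of z^l over
    the lengths l of the loops, and let dist u be the number of steps from u
    down to the base. Everything follows from the size of F, because of one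
    computation: summed over the successors of u, the function
    w |-> z^(dist w) gives z^(dist u) / z if u is not the base, and F(z) / z at
    the base. Put x = exp(-h) and suppose that F(x) <= 1 while F(r) > 1 for
    r > x.

    - For z = x this function is superharmonic. By induction on the length it
      bounds path counts by a constant times x^-n, which gives R >= x
      ([superharmonic_radius]) and an entropy at most -ln x for every finite
      subgraph ([gurevich_entropy_le]).
    - For r > x, finitely many loops already have sum of r^l at least 1, so the
      function is subharmonic on the finite subgraph that they form, which has
      at least c r^-n paths and entropy at least -ln r ([loop_gurevich_ge]).
      Also the power series of the paths from v to v diverges at r, since
      otherwise its values P(u) from the various vertices u would satisfy
      P(base) >= F(r) P(base) ([green_infinite]).

    Hence R = x and the Gurevich entropy is h. First returns to the base have
    generating function F, and first returns to a vertex of a loop of length l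
    have generating function f = x^l + (F - x^l) f at x ([first_gen_pos]). So
    the graph is recurrent if F(x) = 1 and transient if F(x) < 1; if moreover
    the sum of l x^l converges, an explicit supersolution bounds the mean
    return time at every vertex ([mean_gen_pos]).

    It remains to choose numbers a n of loops of length p n. With y = x^p, the
    digits of a greedy expansion 1 = sum of a n y^n are bounded, which gives
    the positive recurrent graph ([greedy_multiplicities]); the integer parts
    of y^-n / (2 (n + 1) (n + 2)) give a sum that is below 1 at y and above 1
    beyond y, hence the transient graph ([slow_multiplicities]). In both cases
    two consecutive a N, a (N + 1) are positive, so that the period is p.

    The link between words and topological entropy needs the compactness of the
    space of bi-infinite paths of a finite graph, in the form of a Lebesgue
    number for open covers ([markov_lebesgue_number]). *)

Set Implicit Arguments.
Unset Strict Implicit.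
Unset Printing Implicit Defensive.

Import Order.TTheory GRing.Theory Num.Theory.
Import numFieldNormedType.Exports.

Local Open Scope classical_set_scope.
Local Open Scope ring_scope.
Local Open Scope ereal_scope.

(** * Counting paths by their first step *)

Section counting_paths.
Context (R : realType).

Lemma iter_adde1 n : iter n (adde 1) 0 = n%:R%:E :> \bar R.
Proof. by elim: n => //= n ->; rewrite -nat1r. Qed.

(** Sums of ones over a set can be reindexed and iterated, which turns the
    recursions on path counts into bijections between sets of tuples. *)
Lemma counting_esum (T : choiceType) (A : set T) :
  counting A = \esum_(t in A) 1 :> \bar R.
Proof.
rewrite /counting; case: asboolP => [finA|infA].
  rewrite esum_fset// fsbig_finite//= big_const_seq count_predT.
  by rewrite iter_adde1.
apply/esym/eqyP => M M0.
have [B BA cB] := infinite_set_fset `|Num.ceil M|%N infA.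
apply: (@le_trans _ _ (\sum_(i \in [set` B]) (1 : \bar R))); last first.
  by apply: esum_ge; exists [set` B].
rewrite fsbig_finite//= set_fsetK big_const_seq count_predT.
rewrite iter_adde1 lee_fin (le_trans (ceil_ge M))//.
rewrite (le_trans (ler_norm _))// -intr_norm -[_%:~R]/(`|_|%N%:R)//.
by rewrite ler_nat.
Qed.

Lemma counting_ge0 (T : choiceType) (A : set T) :
  0 <= counting A :> \bar R.
Proof. by rewrite counting_esum; exact: esum_ge0. Qed.

Variable G : graph.

Lemma sorted_cons_tuple (x : G) n (t : n.+1.-tuple G) :
  sorted (@arrow G) (cons_tuple x t) =
  arrow x (thead t) && sorted (@arrow G) t.
Proof. by case/tupleP: t => y t; rewrite /thead tnth0. Qed.

Lemma tnth_cons_max (x : G) n (t : n.+1.-tuple G) :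
  tnth (cons_tuple x t) ord_max = tnth t ord_max.
Proof. by rewrite !(tnth_nth x). Qed.

Lemma paths_cons (u v x : G) n (t : n.+1.-tuple G) :
  paths u v n.+1 (cons_tuple x t) <->
  [/\ x = u, arrow u (thead t) & paths (thead t) v n t].
Proof.
split=> [[] | [-> a [_ tv s]]].
  by rewrite sorted_cons_tuple tnth_cons_max tnth0 => -> tv /andP[].
by split; rewrite ?sorted_cons_tuple ?tnth_cons_max ?a// tnth0.
Qed.

Lemma first_paths_cons (u v x : G) n (t : n.+2.-tuple G) :
  first_paths u v n.+2 (cons_tuple x t) <->
  [/\ x = u, arrow u (thead t) /\ thead t <> v
    & first_paths (thead t) v n.+1 t].
Proof.
split.
  move=> [/paths_cons[-> a p] av]; split => //.
    split => //; have := av (lift ord0 ord0) isT.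
    by rewrite tnthS.
  split => // i /andP[i0 im]; have := av (lift ord0 i).
  rewrite !(tnth_nth x) lift0 /=; apply; exact: im.
move=> [-> [a tv] [p av]]; split; first exact/paths_cons.
move=> i; case: (unliftP ord0 i) => [j|] -> //.
rewrite lift0 !(tnth_nth x) /= -(tnth_nth x) ltnS => jn.
case: (posnP j) => [j0|j0]; last by apply: av; rewrite j0.
by move: tv; rewrite /thead (_ : j = ord0)//; exact: val_inj.
Qed.

(** Common part of the recursions for paths and for first-passage paths: [B w]
    collects the admissible tails that start at [w]. *)
Lemma counting_cons n (u : G) (S : set G) (A : set (n.+2.-tuple G))
    (B : G -> set (n.+1.-tuple G)) :
  (forall x t,
     A (cons_tuple x t) <-> [/\ x = u, S (thead t) & B (thead t) t]) ->
  (forall w t, B w t -> thead t = w) ->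
  counting A = \esum_(w in S) counting (B w) :> \bar R.
Proof.
move=> AB Bh; rewrite counting_esum.
under [RHS]eq_esum do rewrite counting_esum.
rewrite esum_esum//; apply: (reindex_esum _ _ (fun k => cons_tuple u k.2)).
split.
- by move=> [w t] [/= Sw Bt]; apply/AB; rewrite (Bh _ _ Bt).
- move=> [w t] [w' t'] /[!inE] -[/= _ /Bh <-] [/= _ /Bh <-].
  by move=> /(congr1 (fun t : n.+2.-tuple G => behead t)) /= /val_inj ->.
- move=> /= s; case/tupleP: s => x t /AB[-> St Bt].
  by exists (thead t, t).
Qed.

Lemma npathsS (u v : G) n :
  npaths R u v n.+1 = \esum_(w in [set w | arrow u w]) npaths R w v n.
Proof. by apply: counting_cons => [x t|w t []//]; exact: paths_cons. Qed.

(** A first passage in at least two steps begins with a step to a vertex other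
    than the target, which the tail must again avoid until its end; since the
    tail has its start outside the avoidance condition, that step has to be
    excluded by hand. *)
Lemma nfirst_pathsSS (u v : G) n :
  nfirst_paths R u v n.+2 =
  \esum_(w in [set w | arrow u w /\ w <> v]) nfirst_paths R w v n.+1.
Proof.
by apply: counting_cons => [x t|w t [[]//]]; exact: first_paths_cons.
Qed.

Lemma npaths0 (u v : G) : npaths R u v 0 = (u == v)%:R%:E.
Proof.
rewrite /npaths; case: eqVneq => [->|uv].
  rewrite (_ : paths v v 0 = [set [tuple v]]).
    by rewrite counting_esum esum_set1.
  apply/seteqP; split => [t [t0 _ _]|t ->]; last by [].
  by case/tupleP: t t0 => x t /= <-; rewrite tuple0 tnth0; exact: val_inj.
rewrite (_ : paths u v 0 = set0); first by rewrite counting_esum esum_set0.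
apply/seteqP; split => // t [t0 t1 _]; move: uv.
by rewrite -t0 -t1 (_ : ord0 = ord_max) ?eqxx//; exact: val_inj.
Qed.

Lemma nfirst_paths1 (u v : G) : nfirst_paths R u v 1 = (arrow u v)%:R%:E.
Proof.
rewrite /nfirst_paths (_ : first_paths u v 1 = paths u v 1); last first.
  by apply/seteqP; split => [t []//|t pt]; split => // -[[|[]]].
rewrite -/(npaths R u v 1) npathsS.
under eq_esum do rewrite npaths0.
have [a|na] := boolP (arrow u v).
  rewrite (esumID [set v])/=; last by move=> i _; rewrite lee_fin.
  rewrite (_ : _ `&` _ = [set v]); last first.
    by apply/seteqP; split => x /=; [case|move->].
  rewrite esum_set1 ?eqxx ?lee_fin// esum1 ?adde0// => w [_ /=].
  by case: eqP.
by rewrite esum1// => w /= aw; case: eqP => // wv; rewrite -wv aw in na.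
Qed.

Lemma npaths_ge0 (u v : G) n : 0 <= npaths R u v n.
Proof. by rewrite /npaths counting_esum esum_ge0. Qed.

Lemma nfirst_paths_ge0 (u v : G) n : 0 <= nfirst_paths R u v n.
Proof. by rewrite /nfirst_paths counting_esum esum_ge0. Qed.

End counting_paths.

(** * Sums over countable sets and renewal equations *)

Section series.
Context (R : realType).

Lemma esumZl (T : choiceType) (A : set T) (a : T -> \bar R) (x : R) :
  (0 <= x)%R -> (forall t, 0 <= a t) ->
  \esum_(t in A) (x%:E * a t) = x%:E * \esum_(t in A) a t.
Proof.
rewrite le_eqVlt => /predU1P[<- a0|x0 a0].
  by rewrite mul0e esum1// => t _; rewrite mul0e.
have le (b : T -> \bar R) (y : R) : (0 < y)%R -> (forall t, 0 <= b t) ->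
    \esum_(t in A) (y%:E * b t) <= y%:E * \esum_(t in A) b t.
  move=> y0 b0; apply: ge_ereal_sup => _ [X [fX XA] <-].
  rewrite -ge0_mule_fsumr// lee_pmul2l ?lte_fin//.
  by apply: esum_ge; exists X.
apply/eqP; rewrite eq_le le//=.
rewrite -(@lee_pmul2l _ x^-1%:E) ?lte_fin ?invr_gt0//.
rewrite muleA -EFinM mulVf ?gt_eqF// mul1e.
rewrite [leLHS](_ : _ = \esum_(t in A) (x^-1%:E * (x%:E * a t))).
  by apply: le => [|t]; rewrite ?invr_gt0// mule_ge0// lee_fin ltW.
by apply: eq_esum => t _; rewrite muleA -EFinM mulVf ?gt_eqF// mul1e.
Qed.

Lemma esum_subset (T : choiceType) (A B : set T) (f : T -> \bar R) :
  A `<=` B -> \esum_(t in A) f t <= \esum_(t in B) f t.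
Proof.
move=> AB; apply: ge_ereal_sup => _ [X [fX XA] <-]; apply: esum_ge.
by exists X => //; split => // t /XA /AB.
Qed.

Lemma eseries0S (f : nat -> \bar R) : (forall n, f n.+1 = 0) ->
  \sum_(n <oo) f n = f 0%N.
Proof.
move=> f0; apply: cvg_lim => //; rewrite -(cvg_shiftS _) /=.
apply: (@cvg_near_cst _ _ (f 0%N)); apply: nearW => n.
by rewrite big_mkord big_ord_recl big1 ?adde0// => i _; exact: f0.
Qed.

Lemma esum_nneseries (T : choiceType) (A : set T) (a : nat -> T -> \bar R) :
  (forall n t, 0 <= a n t) ->
  \esum_(t in A) \sum_(n <oo) a n t = \sum_(n <oo) \esum_(t in A) a n t.
Proof.
move=> a0; rewrite [RHS]nneseries_esumT; last by move=> n; exact: esum_ge0.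
under eq_esum do rewrite nneseries_esumT//.
rewrite !esum_esum//.
apply: (reindex_esum _ _ (fun k => (k.2, k.1))); split => //=.
- by move=> [n t] [].
- by move=> [n t] [n' t'] _ _ /= [-> ->].
- by move=> [t n] [At _]; exists (n, t).
Qed.

(** All the generating functions below have coefficients that satisfy a
    recursion [a n.+1 u = e n.+1 u + \sum_(w in S u) a n w]. Their series solves
    the corresponding linear system, and is its least nonnegative solution. *)
Section renewal.
Variables (V : choiceType) (S : V -> set V) (e a : nat -> V -> \bar R) (z : R).
Hypothesis z_ge0 : (0 <= z)%R.
Hypothesis e_ge0 : forall n u, 0 <= e n u.
Hypothesis a_ge0 : forall n u, 0 <= a n u.
Hypothesis a0 : forall u, a 0 u = e 0 u.
Hypothesis aS : forall n u, a n.+1 u = e n.+1 u + \esum_(w in S u) a n w.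

Let az_ge0 n u : 0 <= a n u * (z ^+ n)%:E.
Proof. by rewrite mule_ge0// lee_fin exprn_ge0. Qed.

Let ez_ge0 n u : 0 <= e n u * (z ^+ n)%:E.
Proof. by rewrite mule_ge0// lee_fin exprn_ge0. Qed.

Let step n u : a n.+1 u * (z ^+ n.+1)%:E =
  e n.+1 u * (z ^+ n.+1)%:E + z%:E * \esum_(w in S u) (a n w * (z ^+ n)%:E).
Proof.
rewrite aS ge0_muleDl//; last exact: esum_ge0.
congr (_ + _); rewrite -esumZl// muleC -esumZl ?exprn_ge0//.
by apply: eq_esum => w _; rewrite exprS EFinM -muleA [a n w * _]muleC.
Qed.

Lemma renewal_partial N u :
  \sum_(0 <= n < N.+1) a n u * (z ^+ n)%:E =
  \sum_(0 <= n < N.+1) e n u * (z ^+ n)%:E +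
  z%:E * \esum_(w in S u) \sum_(0 <= n < N) a n w * (z ^+ n)%:E.
Proof.
rewrite !big_mkord big_ord_recl [X in _ = X + _]big_ord_recl a0 -addeA.
congr (_ + _); under eq_bigr do rewrite step.
rewrite big_split /=; congr (_ + _).
under eq_esum do rewrite big_mkord.
by rewrite esum_sum// ge0_sume_distrr// => i _; exact: esum_ge0.
Qed.

Lemma renewal_series u :
  \sum_(n <oo) a n u * (z ^+ n)%:E =
  \sum_(n <oo) e n u * (z ^+ n)%:E +
  z%:E * \esum_(w in S u) \sum_(n <oo) a n w * (z ^+ n)%:E.
Proof.
rewrite nneseries_recl// [X in _ = X + _]nneseries_recl// a0 -addeA.
congr (_ + _); rewrite -[in LHS](nneseries_addn 1)// -(nneseries_addn 1)//.
under eq_eseriesr do rewrite addn1 step.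
rewrite nneseriesD//; last first.
  by move=> n _; rewrite mule_ge0// esum_ge0.
rewrite esum_nneseries// nneseriesZl; last by move=> n _; exact: esum_ge0.
by congr (_ + _); apply: eq_eseriesr => n _; rewrite addn1.
Qed.

(** Minimality: a supersolution bounds all the partial sums, by induction on
    the number of terms. Upper bounds obtained in this way make the linear
    equations solvable in the reals. *)
Lemma renewal_le (s psi : V -> \bar R) :
  (forall u, 0 <= psi u) ->
  (forall N u, \sum_(0 <= n < N) e n u * (z ^+ n)%:E <= s u) ->
  (forall u, s u + z%:E * (\esum_(w in S u) psi w) <= psi u) ->
  forall u, \sum_(n <oo) a n u * (z ^+ n)%:E <= psi u.
Proof.
move=> psi0 es sp u; apply: lime_le; first exact: is_cvg_nneseries.
apply: nearW => N; elim: N u => [u|N IH u]; first by rewrite big_geq.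
rewrite renewal_partial (le_trans _ (sp u))// leeD//.
by rewrite lee_wpmul2l ?lee_fin//; exact: le_esum.
Qed.

End renewal.

End series.

(** * Generating functions of paths and of first returns *)

Section generating_functions.
Context (R : realType).
Variable G : graph.
Implicit Types (u v w : G) (z : R).

Definition green z u v : \bar R := \sum_(n <oo) npaths R u v n * (z ^+ n)%:E.

Definition first_gen z u v : \bar R :=
  \sum_(1 <= n <oo) nfirst_paths R u v n * (z ^+ n)%:E.

(** At the radius of convergence of a recurrent graph, this is the mean return
    time of the associated Markov chain when [u = v]. *)
Definition mean_gen z u v : \bar R :=
  \sum_(1 <= n <oo) n%:R%:E * nfirst_paths R u v n * (z ^+ n)%:E.

Definition next_sum (f : G -> \bar R) u : \bar R :=
  \esum_(w in [set w | arrow u w]) f w.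

Lemma next_sum_ge0 (f : G -> \bar R) u :
  (forall w, 0 <= f w) -> 0 <= next_sum f u.
Proof. by move=> f0; exact: esum_ge0. Qed.

Lemma next_sum_ge (f : G -> \bar R) u w :
  (forall w, 0 <= f w) -> arrow u w -> f w <= next_sum f u.
Proof.
move=> f0 uw; apply: esum_ge; exists [set w]; last by rewrite fsbig_set1.
by split; [exact: finite_set1|move=> _ ->].
Qed.

Lemma next_sum_if u v (c : \bar R) (f : G -> \bar R) :
  0 <= c -> (forall w, 0 <= f w) ->
  next_sum (fun w => if w == v then c else f w) u =
  (arrow u v)%:R%:E * c + \esum_(w in [set w | arrow u w /\ w <> v]) f w.
Proof.
move=> c0 f0; rewrite /next_sum (esumID [set v]); last first.
  by move=> w _; case: ifP.
congr (_ + _); last by apply: eq_esum => w [_ /= wv]; case: eqP.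
have [a|na] := boolP (arrow u v); rewrite ?mul1e ?mul0e.
  rewrite (_ : _ `&` _ = [set v]); first by rewrite esum_set1 eqxx.
  by apply/seteqP; split => w /=; [case|move->].
by rewrite esum1// => w [/= aw wv]; rewrite -wv aw in na.
Qed.

Lemma green_ge0 z u v : (0 <= z)%R -> 0 <= green z u v.
Proof.
move=> z0; apply: nneseries_ge0 => n _ _.
by rewrite mule_ge0 ?npaths_ge0// lee_fin exprn_ge0.
Qed.

Lemma first_gen_ge0 z u v : (0 <= z)%R -> 0 <= first_gen z u v.
Proof.
move=> z0; apply: nneseries_ge0 => n _ _.
by rewrite mule_ge0 ?nfirst_paths_ge0// lee_fin exprn_ge0.
Qed.

Let delta v n u : \bar R := if n is 0 then (u == v)%:R%:E else 0.

Let delta_ge0 v n u : 0 <= delta v n u.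
Proof. by case: n => [|n] //=; rewrite lee_fin. Qed.

Let arr v n u : \bar R := if n is 0 then (arrow u v)%:R%:E else 0.

Let arr_ge0 v n u : 0 <= arr v n u.
Proof. by case: n => [|n] //=; rewrite lee_fin. Qed.

Let npathsS0 v n u :
  npaths R u v n.+1 =
  delta v n.+1 u + \esum_(w in [set w | arrow u w]) npaths R w v n.
Proof. by rewrite npathsS /= add0e. Qed.

Let nfirst_pathsS0 v n u :
  nfirst_paths R u v n.+2 =
  arr v n.+1 u + \esum_(w in [set w | arrow u w /\ w <> v])
                   nfirst_paths R w v n.+1.
Proof. by rewrite nfirst_pathsSS /= add0e. Qed.

Lemma greenE z u v : (0 <= z)%R ->
  green z u v = (u == v)%:R%:E + z%:E * next_sum (green z ^~ v) u.
Proof.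
move=> z0; rewrite /green /next_sum.
rewrite (@renewal_series _ _ (fun u => [set w | arrow u w]) (delta v)
  (fun n u => npaths R u v n) z)//.
- by rewrite eseries0S => [|n]; rewrite ?mul0e// mule1.
- by move=> n w; exact: npaths_ge0.
- by move=> w; exact: npaths0.
Qed.

Lemma green_le z v (psi : G -> \bar R) : (0 <= z)%R ->
  (forall u, 0 <= psi u) ->
  (forall u, (u == v)%:R%:E + z%:E * next_sum psi u <= psi u) ->
  forall u, green z u v <= psi u.
Proof.
move=> z0 psi0 sp u; rewrite /green.
apply: (@renewal_le _ _ (fun u => [set w | arrow u w]) (delta v)
  (fun n u => npaths R u v n) z z0 _ _ _ _
  (delta v 0)) => //.
- by move=> n w; exact: npaths_ge0.
- by move=> w; exact: npaths0.
- move=> [|N] w; first by rewrite big_geq// delta_ge0.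
  by rewrite big_mkord big_ord_recl big1 ?adde0 ?mule1// => i _; rewrite mul0e.
Qed.

Let first_gen_shift z u v : (0 <= z)%R -> first_gen z u v =
  z%:E * \sum_(n <oo) nfirst_paths R u v n.+1 * (z ^+ n)%:E.
Proof.
move=> z0; have f0 n : 0 <= nfirst_paths R u v n * (z ^+ n)%:E.
  by rewrite mule_ge0 ?nfirst_paths_ge0// lee_fin exprn_ge0.
rewrite /first_gen -(nneseries_addn 1)// -nneseriesZl; last first.
  by move=> n _; rewrite mule_ge0 ?nfirst_paths_ge0// lee_fin exprn_ge0.
by apply: eq_eseriesr => n _; rewrite addn1 exprS EFinM muleCA.
Qed.

(** First-step equation. The value 1 at the target accounts for the path that
    reaches it in one step, as the series starts at n = 1. *)
Lemma first_genE z u v : (0 <= z)%R ->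
  first_gen z u v =
  z%:E * next_sum (fun w => if w == v then 1 else first_gen z w v) u.
Proof.
move=> z0; rewrite next_sum_if//; last by move=> w; exact: first_gen_ge0.
rewrite first_gen_shift// mule1; congr (_ * _).
have f0 n w : 0 <= nfirst_paths R w v n.+1 by exact: nfirst_paths_ge0.
rewrite (@renewal_series _ _ (fun u => [set w | arrow u w /\ w <> v])
  (arr v) (fun n u => nfirst_paths R u v n.+1) z)//.
- rewrite eseries0S => [|n]; rewrite ?mul0e// mule1 -esumZl//.
    by congr (_ + _); apply: eq_esum => w _; rewrite first_gen_shift.
  move=> w; apply: nneseries_ge0 => n _ _.
  by rewrite mule_ge0// lee_fin exprn_ge0.
- by move=> w; exact: nfirst_paths1.
Qed.

Lemma first_gen_le z v (psi : G -> \bar R) : (0 < z)%R ->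
  (forall u, 0 <= psi u) ->
  (forall u,
     z%:E * next_sum (fun w => if w == v then 1 else psi w) u <= psi u) ->
  forall u, first_gen z u v <= psi u.
Proof.
move=> z0 psi0 sp u; rewrite first_gen_shift ?(ltW z0)//.
have zK y : z%:E * (z^-1%:E * y) = y.
  by rewrite muleA -EFinM divff ?gt_eqF// mul1e.
rewrite -[leRHS]zK.
rewrite lee_pmul2l ?lte_fin//.
have f0 n w : 0 <= nfirst_paths R w v n.+1 by exact: nfirst_paths_ge0.
have iz0 : (0 <= z^-1)%R by rewrite invr_ge0 ltW.
apply: (@renewal_le _ _ (fun u => [set w | arrow u w /\ w <> v])
  (arr v) (fun n u => nfirst_paths R u v n.+1) z (ltW z0) _ _ _ _
  (arr v 0) (fun u => z^-1%:E * psi u)) => //.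
- by move=> w; exact: nfirst_paths1.
- by move=> w; rewrite mule_ge0.
- move=> [|N] w; first by rewrite big_geq// arr_ge0.
  by rewrite big_mkord big_ord_recl big1 ?adde0 ?mule1// => i _; rewrite mul0e.
- move=> {}u; rewrite esumZl// zK.
  rewrite -(@lee_pmul2l _ z%:E) ?lte_fin// zK.
  by rewrite (le_trans _ (sp u))// next_sum_if// mule1.
Qed.

(** One more step lengthens each first-passage path by 1, so the series with
    the weights n satisfies the first-step equation with the unweighted series
    as inhomogeneous term. *)
Lemma mean_gen_le z v (s psi : G -> \bar R) : (0 < z)%R ->
  (forall u, 0 <= psi u) ->
  (forall u, first_gen z u v <= s u) ->
  (forall u,
     s u + z%:E * next_sum (fun w => if w == v then 0 else psi w) u <= psi u) ->
  forall u, mean_gen z u v <= psi u.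
Proof.
move=> z0 psi0 fs sp u.
have f0 n w : 0 <= nfirst_paths R w v n by exact: nfirst_paths_ge0.
have iz0 : (0 <= z^-1)%R by rewrite invr_ge0 ltW.
have zn0 n : 0 <= (z ^+ n)%:E by rewrite lee_fin exprn_ge0// ltW.
have zK y : z%:E * (z^-1%:E * y) = y.
  by rewrite muleA -EFinM divff ?gt_eqF// mul1e.
have -> : mean_gen z u v = z%:E *
    \sum_(n <oo) (n.+1%:R%:E * nfirst_paths R u v n.+1) * (z ^+ n)%:E.
  rewrite /mean_gen -(nneseries_addn 1)//; last first.
    by move=> n; rewrite !mule_ge0// lee_fin.
  rewrite -nneseriesZl; last by move=> n _; rewrite !mule_ge0// lee_fin.
  by apply: eq_eseriesr => n _; rewrite addn1 exprS EFinM muleCA.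
rewrite -[leRHS]zK.
rewrite lee_pmul2l ?lte_fin//.
apply: (@renewal_le _ _ (fun u => [set w | arrow u w /\ w <> v])
  (fun n u => nfirst_paths R u v n.+1)
  (fun n u => n.+1%:R%:E * nfirst_paths R u v n.+1) z (ltW z0) _ _ _ _
  (fun u => z^-1%:E * s u) (fun u => z^-1%:E * psi u)).
- by move=> n w; exact: f0.
- by move=> n w; rewrite mule_ge0// lee_fin.
- by move=> w; rewrite mul1e.
- move=> n w; rewrite nfirst_pathsSS -esumZl// -esumD//; last first.
    by move=> *; rewrite mule_ge0// lee_fin.
  apply: eq_esum => t _.
  by rewrite -[in LHS]nat1r EFinD ge0_muleDl ?mul1e// lee_fin.
- by move=> w; rewrite mule_ge0.
- move=> N w; rewrite -(@lee_pmul2l _ z%:E) ?lte_fin//.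
  rewrite zK (le_trans _ (fs w))//.
  rewrite first_gen_shift ?(ltW z0)// lee_pmul2l ?lte_fin//.
  by apply: nneseries_lim_ge => n _ _; rewrite mule_ge0.
- move=> {}u; rewrite esumZl// zK.
  rewrite -(@lee_pmul2l _ z%:E) ?lte_fin// zK.
  have s0 : 0 <= s u by rewrite (le_trans _ (fs u))// first_gen_ge0 ?ltW.
  rewrite ge0_muleDr ?zK ?mule_ge0 ?esum_ge0//.
  by rewrite (le_trans _ (sp u))// next_sum_if// mule0 add0e.
Qed.

End generating_functions.

(** * Superharmonic functions and the radius of convergence *)

Section superharmonic.
Context (R : realType).
Variable G : graph.
Implicit Types (u v w : G) (z : R).

Definition superharmonic z (phi : G -> R) :=
  forall u, z%:E * next_sum (fun w => (phi w)%:E) u <= (phi u)%:E.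

Variables (x : R) (phi : G -> R).
Hypothesis x_gt0 : (0 < x)%R.
Hypothesis phi_gt0 : forall u, (0 < phi u)%R.
Hypothesis phi_super : superharmonic x phi.

Let phi_ge0 u : 0 <= (phi u)%:E.
Proof. by rewrite lee_fin ltW. Qed.

(** Normalised to be 1 at [v], a superharmonic function is a supersolution of
    the first-step equation. *)
Lemma superharmonic_first_gen u v : first_gen x u v <= (phi u / phi v)%:E.
Proof.
apply: (@first_gen_le _ _ x v (fun u => (phi u / phi v)%:E)) => //.
  by move=> w; rewrite lee_fin divr_ge0// ltW.
move=> w; rewrite (_ : (fun t => _) = fun t => (phi v)^-1%:E * (phi t)%:E).
  rewrite /next_sum esumZl ?invr_ge0 ?(ltW (phi_gt0 v))// muleCA.
  rewrite [leRHS](_ : _ = (phi v)^-1%:E * (phi w)%:E).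
    rewrite lee_pmul2l ?lte_fin ?invr_gt0//; exact: phi_super.
  by rewrite -EFinM mulrC.
apply/funext => t; case: eqVneq => [->|_]; last by rewrite mulrC EFinM.
by rewrite -EFinM mulVf// gt_eqF.
Qed.

(** Below [x] the superharmonic inequality holds with the factor [r / x] to
    spare, which pays for the unit mass at [v]. *)
Lemma superharmonic_green r u v : (0 <= r)%R -> (r < x)%R ->
  green r u v < +oo.
Proof.
move=> r0 rx; pose q := (r / x)%R.
have q1 : (0 < 1 - q)%R by rewrite subr_gt0 /q ltr_pdivrMr// mul1r.
(* The constant solves [1 + c * q * phi v = c * phi v]. *)
pose c := ((phi v)^-1 / (1 - q))%R.
have c0 : (0 < c)%R by rewrite divr_gt0// invr_gt0.
apply: (@le_lt_trans _ _ (c * phi u)%:E); last by rewrite ltry.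
apply: (@green_le _ _ r v (fun u => (c * phi u)%:E)) => //.
  by move=> w; rewrite lee_fin mulr_ge0// ltW.
move=> w.
have -> : r%:E * next_sum (fun t => (c * phi t)%:E) w =
          (c * q)%:E * (x%:E * next_sum (fun t => (phi t)%:E) w).
  under [in LHS]eq_fun do rewrite EFinM.
  rewrite /next_sum esumZl ?(ltW c0)// !muleA -!EFinM.
  by congr (_%:E * _); rewrite /q -mulrA divfK ?gt_eqF// mulrC.
have q0 : (0 <= q)%R by rewrite divr_ge0// ltW.
rewrite (@le_trans _ _ ((w == v)%:R%:E + (c * q)%:E * (phi w)%:E))//.
  by rewrite leeD2l// lee_wpmul2l// lee_fin mulr_ge0// ltW.
have -> : (c * phi w = c * (1 - q) * phi w + c * q * phi w)%R by ring.
rewrite -EFinM -EFinD lee_fin lerD2r.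
case: eqVneq => [->|_]; last first.
  by apply/mulr_ge0; [apply/mulr_ge0|]; exact: ltW.
by rewrite /c divfK ?gt_eqF// mulVf// gt_eqF.
Qed.

Lemma superharmonic_radius u v : x%:E <= convergence_radius R u v.
Proof.
apply/lee_subgt0Pr => e e0.
have [ex|xe] := ltP e x; last first.
  rewrite (@le_trans _ _ 0)// -?EFinB ?lee_fin ?subr_le0//.
  apply: ereal_sup_ubound; exists 0%R => //; split => //.
  exact: superharmonic_green.
apply: ereal_sup_ubound; exists (x - e)%R => //=; split.
  by rewrite subr_ge0 ltW.
by apply: superharmonic_green; rewrite ?subr_ge0 ?gtrBl// ltW.
Qed.

End superharmonic.

Lemma radius_le (R : realType) (G : graph) (u v : G) (x : R) :
  (forall r, (x < r)%R -> (0 <= r)%R -> green r u v = +oo) ->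
  convergence_radius R u v <= x%:E.
Proof.
move=> xr; apply: ge_ereal_sup => _ [r [r0 rv] <-]; rewrite lee_fin leNgt.
by apply/negP => /xr/(_ r0) roo; move: rv; rewrite -/(green r u v) roo.
Qed.

(** * Loops through a common vertex *)

Section loop_graph.
Variables (I : countType) (d : I -> nat).

(** [None] is the base, and loop [i] has [d i + 1] further vertices, numbered
    by the distance to the exit: an arrow goes from the base to [d i], from
    [k + 1] to [k], and from [0] to the base. Thus loop [i] has length
    [d i + 2]; loops of length 1 are excluded since only one of them could
    exist. Numbering downwards makes [dist] independent of [d]. *)
Definition loop_vertex : countType := option {i : I & 'I_(d i).+1}.

Definition dist (u : loop_vertex) : nat :=
  if u is Some s then (tagged s).+1 else 0%N.

Definition loop_arrow (u v : loop_vertex) : bool :=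
  match u, v with
  | None, None => false
  | None, Some t => tagged t == d (tag t) :> nat
  | Some s, None => tagged s == 0%N :> nat
  | Some s, Some t => (tag s == tag t) && (tagged s == (tagged t).+1 :> nat)
  end.

Definition loop_graph : graph := Graph loop_arrow.

Definition base : loop_graph := None.

Definition pos i k : loop_graph :=
  Some (Tagged (fun i => 'I_(d i).+1) (inord k : 'I_(d i).+1)).

Variant loop_vertex_spec : loop_graph -> Type :=
  | BaseSpec : loop_vertex_spec base
  | PosSpec i k of (k <= d i)%N : loop_vertex_spec (pos i k).

Lemma loop_vertexP (u : loop_graph) : loop_vertex_spec u.
Proof.
case: u => [[i k]|]; last exact: BaseSpec.
have := @PosSpec i k (ltn_ord k).
by rewrite /pos inord_val.
Qed.

Lemma dist_pos i k : (k <= d i)%N -> dist (pos i k) = k.+1.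
Proof. by move=> kd /=; rewrite inordK. Qed.

Lemma pos_inj i j k l : (k <= d i)%N -> (l <= d j)%N ->
  pos i k = pos j l -> i = j /\ k = l.
Proof.
move=> ki lj e; have := dist_pos ki; rewrite e dist_pos// => -[<-].
by split => //; case: e.
Qed.

Lemma arrow_pos_base i k : (k <= d i)%N ->
  arrow (pos i k) base = (k == 0%N).
Proof. by move=> ki; rewrite /= inordK. Qed.

Lemma arrow_base_pos i k : (k <= d i)%N ->
  arrow base (pos i k) = (k == d i).
Proof. by move=> ki; rewrite /= inordK. Qed.

Lemma arrow_pos_pos i j k l : (k <= d i)%N -> (l <= d j)%N ->
  arrow (pos i k) (pos j l) = (i == j) && (k == l.+1).
Proof. by move=> ki lj; rewrite /= !inordK. Qed.

(** Along an arrow [dist] drops by 1, except at the base, where it jumps from 0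
    to [d i + 1], that is to -1 modulo the length of the loop. *)
Lemma arrow_dist_mod (p : nat) : (forall i, (p %| (d i).+2)%N) ->
  forall u v : loop_graph, arrow u v -> dist u = (dist v).+1 %[mod p].
Proof.
move=> pd u v; case: (loop_vertexP u) => [|i k ki];
  case: (loop_vertexP v) => [|j l lj] //.
- rewrite arrow_base_pos// dist_pos// => /eqP ->.
  by rewrite [RHS](eqP (pd j)) mod0n.
- by rewrite arrow_pos_base// dist_pos// => /eqP ->.
- by rewrite arrow_pos_pos// !dist_pos// => /andP[_ /eqP ->].
Qed.

Section sums.
Context (R : realType).

Lemma next_sum_pos0 (f : loop_graph -> \bar R) i : (forall w, 0 <= f w) ->
  next_sum f (pos i 0) = f base.
Proof.
move=> f0; rewrite /next_sum (_ : [set w | _] = [set base]) ?esum_set1//.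
apply/seteqP; split => [w|w ->]; last by rewrite /= inordK.
case: (loop_vertexP w) => [//|j l lj].
by rewrite /mkset arrow_pos_pos// andbF.
Qed.

Lemma next_sum_posS (f : loop_graph -> \bar R) i k : (forall w, 0 <= f w) ->
  (k.+1 <= d i)%N -> next_sum f (pos i k.+1) = f (pos i k).
Proof.
move=> f0 ki; rewrite /next_sum (_ : [set w | _] = [set pos i k]) ?esum_set1//.
apply/seteqP; split => [w|w ->]; last first.
  by rewrite /mkset arrow_pos_pos ?eqxx// ltnW.
rewrite /mkset; case: (loop_vertexP w) => [|j l lj].
  by rewrite arrow_pos_base.
by rewrite arrow_pos_pos// => /andP[/eqP <- /eqP[<-]].
Qed.

Lemma next_sum_base (f : loop_graph -> \bar R) : (forall w, 0 <= f w) ->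
  next_sum f base = \esum_(i in [set: I]) f (pos i (d i)).
Proof.
move=> f0; apply: (reindex_esum _ _ (fun i => pos i (d i))); split.
- by move=> i _; rewrite /mkset arrow_base_pos.
- by move=> i j _ _ /pos_inj[].
- move=> w; rewrite /mkset; case: (loop_vertexP w) => [//|i k ki].
  by rewrite arrow_base_pos// => /eqP ->; exists i.
Qed.

(** Generating function of the simple loops at the base, by length. *)
Definition loop_gen (z : R) : \bar R :=
  \esum_(i in [set: I]) (z ^+ (d i).+2)%:E.

Definition weight (z : R) (u : loop_graph) : R := (z ^+ dist u)%R.

Lemma weight_pos (z : R) i k : (k <= d i)%N ->
  weight z (pos i k) = (z ^+ k.+1)%R.
Proof. by move=> ki; rewrite /weight dist_pos. Qed.

Lemma next_sum_weight_pos (z : R) i k : (0 <= z)%R -> (k <= d i)%N ->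
  z%:E * next_sum (fun w => (weight z w)%:E) (pos i k) =
  (weight z (pos i k))%:E.
Proof.
move=> z0; have w0 w : 0 <= (weight z w)%:E by rewrite lee_fin exprn_ge0.
case: k => [|k] ki.
  by rewrite next_sum_pos0// weight_pos// mule1 expr1.
rewrite (next_sum_posS w0 ki) (weight_pos z ki) (weight_pos z (ltnW ki)).
by rewrite -EFinM -exprS.
Qed.

Lemma next_sum_weight_base (z : R) : (0 <= z)%R ->
  z%:E * next_sum (fun w => (weight z w)%:E) base = loop_gen z.
Proof.
move=> z0; have w0 w : 0 <= (weight z w)%:E by rewrite lee_fin exprn_ge0.
rewrite next_sum_base// -esumZl//; apply: eq_esum => i _.
by rewrite weight_pos// -EFinM -exprS.
Qed.

(** The weight is harmonic off the base, and at the base the condition reads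
    [loop_gen d x <= 1]. *)
Lemma weight_superharmonic (x : R) : (0 <= x)%R -> loop_gen x <= 1 ->
  superharmonic x (weight x).
Proof.
move=> x0 F1 u; case: (loop_vertexP u) => [|i k ki].
  by rewrite next_sum_weight_base.
by rewrite next_sum_weight_pos.
Qed.

End sums.
End loop_graph.

(** * Connectedness, period and divergence beyond the radius *)

Section walks.
Variable G : graph.
Implicit Types (u v w : G).

Definition walk u v n :=
  exists s : seq G, [/\ path (@arrow G) u s, last u s = v & size s = n].

Lemma pathsP u v n : paths u v n !=set0 <-> walk u v n.
Proof.
split=> [[t]|[s [us sv sn]]].
  case/tupleP: t => x t [/=]; rewrite tnth0 => -> tv p; exists t; split => //.
    by rewrite -tv (tnth_nth x) /= (last_nth x) size_tuple.
  exact: size_tuple.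
exists (@Tuple _ _ (u :: s) (introT eqP (congr1 S sn))); split => //.
  by rewrite (tnth_nth u) /= -sn -[RHS]sv (last_nth u).
Qed.

Lemma walk_step u v : arrow u v -> walk u v 1.
Proof. by move=> uv; exists [:: v]; rewrite /= uv. Qed.

Lemma walk_cat u v w m n : walk u v m -> walk v w n -> walk u w (m + n).
Proof.
move=> [s [us <- <-]] [t [st <- <-]]; exists (s ++ t).
by rewrite cat_path us st last_cat size_cat.
Qed.

(** Preceding the paths from [w] by a fixed walk from [u] to [w] is injective.
    *)
Lemma green_walk (R : realType) (r : R) u v w n : (0 <= r)%R -> walk u w n ->
  (r ^+ n)%:E * green r w v <= green r u v.
Proof.
move=> r0 [s [us <- <-]]; elim: s u us => [|t s IH] u /=.
  by rewrite mul1e.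
move=> /andP[ut ts]; rewrite exprS EFinM -muleA.
rewrite (@le_trans _ _ (r%:E * green r t v))//.
  by rewrite lee_wpmul2l ?lee_fin// IH.
rewrite [leRHS]greenE// (@le_trans _ _ (r%:E * next_sum (green r ^~ v) u))//.
  rewrite lee_wpmul2l ?lee_fin//.
  by apply: (@next_sum_ge _ _ (green r ^~ v)) => // ?; exact: green_ge0.
by rewrite leeDr// lee_fin.
Qed.

End walks.

Section loop_graph_walks.
Variables (I : countType) (d : I -> nat).
Local Notation G := (loop_graph d).
Local Notation base := (base d).
Local Notation pos := (@pos I d).

Lemma walk_to_base i k : (k <= d i)%N -> walk (pos i k) base k.+1.
Proof.
elim: k => [|k IH] ki; first by apply: walk_step; rewrite arrow_pos_base.
apply: (@walk_cat _ _ _ _ 1 k.+1 _ (IH (ltnW ki))); apply: walk_step.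
by rewrite arrow_pos_pos ?eqxx// ltnW.
Qed.

Lemma walk_from_base i k : (k <= d i)%N ->
  walk base (pos i (d i - k)) k.+1.
Proof.
elim: k => [|k IH] ki.
  by apply: walk_step; rewrite subn0 arrow_base_pos.
rewrite -addn1; apply: walk_cat (IH (ltnW ki)) _; apply: walk_step.
by rewrite arrow_pos_pos ?leq_subr// eqxx/=; lia.
Qed.

Lemma walk_base u : exists m n, walk u base m /\ walk base u n.
Proof.
case: (loop_vertexP u) => [|i k ki].
  by exists 0%N, 0%N; split; exists [::].
exists k.+1, (d i - k).+1; split; first exact: walk_to_base.
by have := @walk_from_base i (d i - k) (leq_subr _ _); rewrite subKn.
Qed.

Lemma loop_graph_connected : strongly_connected G.
Proof.
move=> u v; have [m [_ [um _]]] := walk_base u.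
have [_ [n [_ nv]]] := walk_base v.
by exists (m + n)%N; apply/pathsP; exact: walk_cat um nv.
Qed.

Lemma loop_return_time i : return_times G (d i).+2.
Proof.
split => //; exists base; apply/pathsP.
have := @walk_from_base i 0 isT; rewrite subn0 => bi.
exact: walk_cat bi (walk_to_base (leqnn _)).
Qed.

Lemma loop_graph_period p : (forall i, (p %| (d i).+2)%N) ->
  (forall q, (forall i, (q %| (d i).+2)%N) -> (q %| p)%N) -> has_period G p.
Proof.
move=> pd qp; split => [n [n0 [u /pathsP[s [us su sn]]]]|q qn]; last first.
  by apply: qp => i; apply: qn; exact: loop_return_time.
suff : (dist u = dist (last u s) + size s %[mod p])%N.
  rewrite su sn -[X in (X = _ %[mod _])%N]addn0 => /eqP.
  by rewrite eqn_modDl mod0n eq_sym.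
elim: s u us {su sn} => [|t s IH] u /=; first by rewrite addn0.
move=> /andP[/(arrow_dist_mod pd) -> /IH h].
by rewrite -addn1 -modnDml h modnDml addn1 addnS.
Qed.

(** If the series were finite at [v] it would be finite and positive at the
    base, by connectedness; following each loop once multiplies its value there
    by [loop_gen d r], which exceeds 1. *)
Lemma green_infinite (R : realType) (r : R) (v : G) : (0 < r)%R ->
  1 < loop_gen d r -> green r v v = +oo.
Proof.
move=> r0 F1; apply/eqP; rewrite -leye_eq leNgt; apply/negP => vfin.
have g0 w : 0 <= green r w v by rewrite green_ge0// ltW.
have [m [n [vb bv]]] := walk_base v.
have gv : 1 <= green r v v.
  rewrite [leRHS]greenE ?(ltW r0)// eqxx -[leLHS]/(true%:R%:E) leeDl//.
  by rewrite mule_ge0 ?lee_fin ?(ltW r0)//; exact: next_sum_ge0.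
have b0 : 0 < green r base v.
  apply: lt_le_trans (green_walk _ (ltW r0) bv).
  by rewrite mule_gt0 ?lte_fin ?exprn_gt0// (lt_le_trans _ gv).
have boo : green r base v < +oo.
  have := le_lt_trans (green_walk v (ltW r0) vb) vfin.
  case: (green r base v) b0 => [g _ _||] //; first exact: ltry.
  move=> _; by rewrite gt0_muley ?ltxx// lte_fin exprn_gt0.
suff : loop_gen d r * green r base v <= green r base v.
  have /fineK <- : green r base v \is a fin_num by rewrite gt0_fin_numE.
  apply/negP; rewrite -ltNge lte_pmull//.
  by case: (green r base v) b0 boo.
rewrite [leRHS]greenE ?(ltW r0)//.
rewrite (@le_trans _ _ (r%:E * next_sum (green r ^~ v) base))//; last first.
  by rewrite leeDr// lee_fin.
rewrite next_sum_base// -esumZl ?(ltW r0)//.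
have /fineK <- : green r base v \is a fin_num by rewrite gt0_fin_numE.
rewrite muleC /loop_gen -esumZl ?fine_ge0//; last first.
  by move=> i; rewrite lee_fin exprn_ge0// ltW.
apply: le_esum => i _; rewrite muleC fineK ?gt0_fin_numE// exprS EFinM -muleA.
rewrite lee_wpmul2l ?lee_fin ?(ltW r0)//.
exact: (green_walk v (ltW r0) (@walk_to_base i (d i) (leqnn _))).
Qed.

End loop_graph_walks.

(** * First returns in a loop graph *)

Section loop_graph_returns.
Context (R : realType).
Variables (I : countType) (d : I -> nat) (x : R).
Hypothesis x_gt0 : (0 < x)%R.
Hypothesis gen_le1 : loop_gen d x <= 1.
Local Notation G := (loop_graph d).
Local Notation base := (base d).
Local Notation pos := (@pos I d).
Local Notation hit v := (fun w => if w == v then 1 else first_gen x w v).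

Let hit_ge0 (v w : G) : 0 <= hit v w.
Proof. by rewrite /=; case: ifP => // _; rewrite first_gen_ge0// ltW. Qed.

Lemma first_gen_le_weight (u v : G) :
  first_gen x u v <= (weight x u / weight x v)%:E.
Proof.
apply: superharmonic_first_gen => // [w|]; first by rewrite exprn_gt0.
by apply: weight_superharmonic => //; exact: ltW.
Qed.

Lemma first_gen_fin_num (u v : G) : first_gen x u v \is a fin_num.
Proof.
rewrite ge0_fin_numE ?first_gen_ge0 ?(ltW x_gt0)//.
exact: le_lt_trans (first_gen_le_weight u v) (ltry _).
Qed.

(** A path from [pos i k] is forced down to the base, and starts afresh there
    unless the base is the target. *)
Lemma first_gen_descent (v : G) i k : (k <= d i)%N ->
  (forall l, (l < k)%N -> pos i l != v) ->
  first_gen x (pos i k) v = (x ^+ k.+1)%:E * hit v base.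
Proof.
elim: k => [|k IH] ki nv; rewrite first_genE ?(ltW x_gt0)//.
  by rewrite (next_sum_pos0 _ (hit_ge0 v)) expr1.
rewrite (next_sum_posS (hit_ge0 v) ki) ifN ?nv// IH ?(ltnW ki)//; last first.
  by move=> l lk; rewrite nv// ltnS ltnW.
by rewrite muleA -EFinM -exprS.
Qed.

Lemma first_gen_above i k l : (l < k)%N -> (k <= d i)%N ->
  first_gen x (pos i k) (pos i l) = (x ^+ (k - l))%:E.
Proof.
elim: k => [//|k IH] lk ki; rewrite first_genE ?(ltW x_gt0)//.
rewrite (next_sum_posS (hit_ge0 _) ki) subSn//.
have [e|kl] := eqVneq k l; first by rewrite e eqxx subnn mule1 expr1.
have {}lk : (l < k)%N by rewrite ltn_neqAle eq_sym kl.
case: eqP => [/pos_inj[||_ kl']|_]; [exact: ltnW|exact: ltnW (ltn_trans lk _)| |].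
  by rewrite kl' eqxx in kl.
by rewrite IH ?(ltnW ki)// -EFinM -exprS.
Qed.

Lemma first_gen_base : first_gen x base base = loop_gen d x.
Proof.
rewrite first_genE ?(ltW x_gt0)// (next_sum_base (hit_ge0 _)).
rewrite -esumZl ?(ltW x_gt0)//; last first.
  by move=> i; exact: first_gen_ge0 (ltW x_gt0).
apply: eq_esum => i _; rewrite first_gen_descent// eqxx mule1.
by rewrite -EFinM -exprS.
Qed.

Lemma loop_gen_split j : loop_gen d x =
  (x ^+ (d j).+2)%:E + \esum_(i in [set~ j]) (x ^+ (d i).+2)%:E.
Proof.
have x0 i : 0 <= (x ^+ (d i).+2)%:E by rewrite lee_fin exprn_ge0// ltW.
by rewrite /loop_gen (esumID [set j])// !setTI esum_set1.
Qed.

(** A first return to a vertex of loop [j] goes down to the base, follows loops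
    other than [j] any number of times, and comes back along loop [j]: the
    generating function is that of a geometric series. *)
Lemma first_gen_pos j k : (k <= d j)%N ->
  let f := first_gen x (pos j k) (pos j k) in
  f = (x ^+ (d j).+2)%:E + (\esum_(i in [set~ j]) (x ^+ (d i).+2)%:E) * f.
Proof.
move=> kj; set v := pos j k; set F := \esum_(i in _) _.
have x0 n : 0 <= (x ^+ n)%:E by rewrite lee_fin exprn_ge0// ltW.
have F0 : 0 <= F by exact: esum_ge0.
have nv i l : (l <= d i)%N -> pos i l = v -> i = j /\ l = k.
  by move=> li /pos_inj; apply.
have -> : first_gen x v v = (x ^+ k.+1)%:E * first_gen x base v.
  rewrite [LHS]first_gen_descent// => l lk.
  by apply/eqP => /nv[|_ lk']; [exact: ltnW (leq_trans lk kj)|lia].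
set hb := first_gen x base v => /=.
suff hE : hb = (x ^+ (d j - k).+1)%:E + F * hb.
  rewrite {1}hE ge0_muleDr ?mule_ge0 ?first_gen_ge0 ?(ltW x_gt0)//.
  by rewrite -EFinM -exprD addSn addnS subnKC// muleCA.
have hb0 : 0 <= hb by rewrite first_gen_ge0// ltW.
rewrite {1}/hb first_genE ?(ltW x_gt0)// (next_sum_base (hit_ge0 _)).
rewrite (esumID [set j])//.
rewrite !setTI esum_set1// ge0_muleDr ?esum_ge0//; congr (_ + _).
  have [dk|dk] := eqVneq (d j) k; first by rewrite dk eqxx subnn mule1 expr1.
  have kd : (k < d j)%N by rewrite ltn_neqAle eq_sym dk.
  case: eqP => [/nv[//|_ kd']|_]; first by rewrite kd' eqxx in dk.
  by rewrite first_gen_above// -EFinM -exprS.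
rewrite -esumZl ?(ltW x_gt0)//.
have /fineK hbE : hb \is a fin_num by exact: first_gen_fin_num.
rewrite -hbE muleC -esumZl ?fine_ge0//.
apply: eq_esum => i /= ij; rewrite ifN; last first.
  by apply/eqP => /nv[].
rewrite first_gen_descent//; last first.
  by move=> l li; apply/eqP => /nv[|//]; exact: ltnW.
by rewrite (_ : (base == v) = false)// -/hb hbE muleA -EFinM -exprS muleC.
Qed.

Lemma first_gen_recurrent (u : G) : loop_gen d x = 1 -> first_gen x u u = 1.
Proof.
move=> F1; case: (loop_vertexP u) => [|j k kj].
  by rewrite first_gen_base.
have := first_gen_pos kj => /=; move: F1; rewrite (loop_gen_split j).
have := first_gen_fin_num (pos j k) (pos j k).
case: (first_gen _ _ _) => // f _.
case: (\esum_(_ in _) _) => // F [xF] [fE].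
congr (_%:E); apply: (@mulfI _ (1 - F)%R); last by lra.
by rewrite -xF addrK gt_eqF// exprn_gt0.
Qed.

Lemma first_gen_transient (u : G) : loop_gen d x < 1 -> first_gen x u u < 1.
Proof.
move=> F1; case: (loop_vertexP u) => [|j k kj].
  by rewrite first_gen_base.
have := first_gen_pos kj => /=; move: F1; rewrite (loop_gen_split j).
have := first_gen_fin_num (pos j k) (pos j k).
have := exprn_gt0 (d j).+2 x_gt0.
case: (first_gen _ _ _) => // f x0 _.
have : 0 <= \esum_(i in [set~ j]) (x ^+ (d i).+2)%:E.
  by apply: esum_ge0 => i _; rewrite lee_fin exprn_ge0// ltW.
case: (\esum_(_ in _) _) => // F; rewrite !lee_fin !lte_fin => F0 F1 [fE].
rewrite -(@ltr_pM2l _ (1 - F)%R); lra.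
Qed.

Definition loop_mean : \bar R :=
  \esum_(i in [set: I]) ((d i).+2%:R * x ^+ (d i).+2)%:E.

Hypothesis mean_fin : loop_mean < +oo.

Let loop_mean0 : 0 <= loop_mean.
Proof.
by apply: esum_ge0 => i _; rewrite lee_fin mulr_ge0// exprn_ge0// ltW.
Qed.

Let loop_meanK : (fine loop_mean)%:E = loop_mean.
Proof. by rewrite fineK// ge0_fin_numE. Qed.

Let xn_gt0 n : (0 < x ^+ n)%R.
Proof. exact: exprn_gt0. Qed.

Let xn_ge0 n : (0 <= x ^+ n)%R.
Proof. exact: ltW. Qed.

(** Off the base the supersolution is the exact value: there is a single
    first-passage path from [u], of length [dist u]. *)
Lemma mean_gen_base : mean_gen x base base < +oo.
Proof.
pose psi (u : G) : R :=
  (weight x u * (if u == base then 1 + fine loop_mean else (dist u)%:R))%R.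
have D0 : (0 <= fine loop_mean)%R by exact: fine_ge0.
have psi0 u : 0 <= (psi u)%:E.
  rewrite lee_fin mulr_ge0//; first exact: xn_ge0.
  by case: ifP => // _; rewrite addr_ge0.
have psi_base : psi base = (1 + fine loop_mean)%R.
  by rewrite /psi eqxx /weight /= expr0 mul1r.
have psi_pos i k : (k <= d i)%N ->
    psi (pos i k) = (x ^+ k.+1 * k.+1%:R)%R.
  by move=> ki; rewrite /psi weight_pos// dist_pos.
clearbody psi.
apply: (@le_lt_trans _ _ (psi base)%:E); last exact: ltry.
apply: (@mean_gen_le _ _ x base (fun u => (weight x u)%:E)
  (fun u => (psi u)%:E)) => // [u|u].
  have := first_gen_le_weight u base.
  by rewrite {2}/weight /= expr0 divr1.
have g0 w : 0 <= (if w == base then 0 else (psi w)%:E) by case: ifP.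
case: (loop_vertexP u) => [|i [|k] ki].
- rewrite (next_sum_base g0) -esumZl ?(ltW x_gt0)//.
  rewrite psi_base EFinD leeD2l// loop_meanK.
  apply: le_esum => i _; rewrite psi_pos// -EFinM lee_fin.
  by rewrite mulrA -exprS mulrC ler_pM2r ?exprn_gt0// ler_nat.
- by rewrite (next_sum_pos0 _ g0) eqxx mule0 adde0 psi_pos// mulr1 weight_pos.
- rewrite (next_sum_posS g0 ki)//.
  rewrite psi_pos ?(ltnW ki)// psi_pos// weight_pos// -EFinM -EFinD lee_fin.
  by rewrite mulrA -exprS -[in leRHS]nat1r mulrDr mulr1.
Qed.

(** The supersolution [psi] is read off the shape of the first-passage paths:
    [c * weight] bounds the first-passage series, the term [c * dist] adds up
    the inhomogeneous terms on the way down to the base, and [K] is the value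
    at the base, carried down the loops except from the vertices [behind] the
    target, which is reached before the base. At the base the loops other than
    [j] have total weight at most [1 - x ^+ (d j).+2], so [K] must satisfy
    [K * x ^+ (d j).+2 >= c * (1 + loop_mean)]. *)
Lemma mean_gen_pos j k : (k <= d j)%N ->
  mean_gen x (pos j k) (pos j k) < +oo.
Proof.
move=> kj; set v := pos j k.
have nv i l : (l <= d i)%N -> pos i l = v -> i = j /\ l = k.
  by move=> li /pos_inj; apply.
have D0 : (0 <= fine loop_mean)%R by exact: fine_ge0.
pose c : R := ((weight x v)^-1)%R.
pose K : R := (c * (1 + fine loop_mean) / x ^+ (d j).+2)%R.
have c0 : (0 < c)%R by rewrite invr_gt0 exprn_gt0.
have K0 : (0 <= K)%R.
  by rewrite divr_ge0// mulr_ge0 ?addr_ge0// ltW.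
pose behind (u : G) : bool :=
  if u is Some t then (tag t == j) && (k < tagged t)%N else false.
have behind_pos i l : (l <= d i)%N ->
    behind (pos i l) = (i == j) && (k < l)%N.
  by move=> li; rewrite /behind /= inordK.
pose psi (u : G) : R :=
  (weight x u * (K * (~~ behind u)%:R + c * (dist u)%:R))%R.
have psi_pos i l : (l <= d i)%N -> psi (pos i l) =
    (x ^+ l.+1 * (K * (~~ ((i == j) && (k < l)%N))%:R + c * l.+1%:R))%R.
  by move=> li; rewrite /psi weight_pos// dist_pos// behind_pos.
have psi_base : psi base = K by rewrite /psi /weight /=; ring.
have psi0 u : 0 <= (psi u)%:E.
  rewrite lee_fin mulr_ge0//; first exact: xn_ge0.
  by rewrite addr_ge0// mulr_ge0// ltW.
clearbody psi.
apply: (@le_lt_trans _ _ (psi v)%:E); last exact: ltry.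
apply: (@mean_gen_le _ _ x v (fun u => (weight x u * c)%:E)
  (fun u => (psi u)%:E)) => // [u|u]; first exact: first_gen_le_weight.
have g0 w : 0 <= (if w == v then 0 else (psi w)%:E) by case: ifP.
case: (loop_vertexP u) => [|i [|l] li].
- rewrite (next_sum_base g0) -esumZl ?(ltW x_gt0)//.
  rewrite psi_base /weight /= expr0 mul1r.
  set F := \esum_(i in [set~ j]) (x ^+ (d i).+2)%:E.
  have F0 : 0 <= F.
    by apply: esum_ge0 => i _; rewrite lee_fin.
  apply: (@le_trans _ _ (c%:E + (K%:E * F + c%:E * loop_mean))).
    rewrite leeD2l// /F esum_mkcond -esumZl//; last first.
      by move=> i; case: ifP => // _; rewrite lee_fin.
    rewrite -esumZl ?(ltW c0)//; last first.
      by move=> i; rewrite lee_fin mulr_ge0.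
    rewrite -esumD//; last 2 first.
    - move=> i _; rewrite mule_ge0//.
      by case: ifP => // _; rewrite lee_fin.
    - by move=> i _; rewrite mule_ge0// lee_fin ?(ltW c0)// mulr_ge0.
    apply: le_esum => i _.
    have tail : (c * ((d i).+1%:R * x ^+ (d i).+2) <=
                 c * ((d i).+2%:R * x ^+ (d i).+2))%R.
      by rewrite ler_pM2l// ler_wpM2r// ler_nat.
    case: (eqVneq i j) => [ij|ij]; last first.
      rewrite ifN; last by apply/eqP => /nv[|/eqP]; rewrite ?(negPf ij).
      rewrite ifT; last by rewrite inE; apply/eqP.
      rewrite psi_pos// (negPf ij) /= -!EFinM -EFinD lee_fin.
      apply: le_trans (lerD (lexx _) tail); rewrite le_eqVlt; apply/orP; left.
      by apply/eqP; rewrite mulr1 [in LHS]mulrA -exprS; ring.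
    rewrite [X in K%:E * X]ifN ?mule0 ?add0e; last first.
      by rewrite notin_setE; apply.
    case: eqP => [_|kd].
      by rewrite mule0 mule_ge0// lee_fin ?(ltW c0)// mulr_ge0.
    rewrite psi_pos// ij eqxx /= (_ : (k < d j)%N)/=; last first.
      rewrite ltn_neqAle kj andbT; apply/eqP => kd'.
      by apply: kd; rewrite /v kd' ij.
    rewrite ij in tail; rewrite mulr0 add0r -!EFinM lee_fin.
    apply: le_trans tail; rewrite le_eqVlt; apply/orP; left.
    by rewrite [in eqbRHS]exprS; apply/eqP; ring.
  have Fx : (x ^+ (d j).+2)%:E + F <= 1 by rewrite /F -loop_gen_split.
  have /fineK FE : F \is a fin_num.
    rewrite ge0_fin_numE//; apply: le_lt_trans (ltry 1); apply: le_trans Fx.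
    by rewrite leeDr// lee_fin.
  move: Fx; rewrite -FE -loop_meanK -!EFinM -!EFinD !lee_fin => Fx.
  have : (K * (x ^+ (d j).+2 + fine F) <= K)%R by rewrite ler_piMr.
  by rewrite mulrDr divfK ?gt_eqF//; lra.
- rewrite (next_sum_pos0 _ g0) /= psi_base psi_pos// andbF weight_pos//.
  by rewrite -EFinM -EFinD lee_fin expr1 !mulr1 mulrDr addrC.
- rewrite (next_sum_posS g0 li) weight_pos//.
  case: eqP => [/nv[|ij lk]|nkl]; first exact: ltnW.
    rewrite ij lk in li *.
    rewrite mule0 adde0 psi_pos// lee_fin eqxx ltnSn/= mulr0 add0r.
    by rewrite ler_pM2l ?exprn_gt0// ler_peMr ?(ltW c0)// ler1n.
  rewrite !psi_pos// ?(ltnW li)// -EFinM -EFinD lee_fin.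
  have -> : (i == j) && (k < l.+1)%N = (i == j) && (k < l)%N.
    case: (eqVneq i j) => //= ij; rewrite ltnS leq_eqVlt.
    by case: eqP => // kl; case: nkl; rewrite /v ij kl.
  rewrite -[l.+2%:R]nat1r le_eqVlt; apply/orP; left.
  by rewrite (exprS x l.+1); apply/eqP; ring.
Qed.

End loop_graph_returns.

(** * Growth of the number of words in a finite graph *)

Section word_counts.
Local Open Scope ring_scope.
Variables (W : finType) (E : rel W).

Definition nwords_from (u : W) n := #|[pred t : n.-tuple W | path E u t]|.

Definition nwords n := #|[pred t : n.-tuple W | sorted E t]|.

Lemma sum_cons_tuple n (P : pred (n.+1.-tuple W)) :
  (\sum_(t : n.+1.-tuple W) P t =
   \sum_(w : W) \sum_(t : n.-tuple W) P [tuple of w :: t])%N.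
Proof.
rewrite pair_bigA /=.
rewrite (reindex (fun p : W * n.-tuple W => [tuple of p.1 :: p.2]))//=.
exists (fun t : n.+1.-tuple W => (thead t, [tuple of behead t])) =>
  [[w t] _|t _] /=.
  by congr (_, _); apply: val_inj.
by rewrite -tuple_eta.
Qed.

Lemma card_sum (T : finType) (P : pred T) :
  #|[pred t | P t]| = (\sum_(t : T) P t)%N.
Proof. by rewrite -sum1_card big_mkcond. Qed.

Lemma card_tuple0 (P : pred (0.-tuple W)) : P [tuple] ->
  #|[pred t | P t]| = 1%N.
Proof.
move=> P0; rewrite (eq_card (B := predT)) ?card_tuple ?expn0// => t.
by rewrite !inE (tuple0 t).
Qed.

Lemma nwords_fromS u n :
  nwords_from u n.+1 = (\sum_(w | E u w) nwords_from w n)%N.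
Proof.
rewrite /nwords_from card_sum sum_cons_tuple [RHS]big_mkcond /=.
apply: eq_bigr => w _; rewrite card_sum; case: (E u w) => //=.
by rewrite big1.
Qed.

Lemma nwordsS n : nwords n.+1 = (\sum_u nwords_from u n)%N.
Proof.
rewrite /nwords card_sum sum_cons_tuple; apply: eq_bigr => u _.
by rewrite /nwords_from card_sum.
Qed.

(** The lower bound [c] of [phi] lets the count be compared with the sum of
    [phi] over the last vertices of the words. *)
Lemma nwords_from_ub (R : realType) (phi : W -> R) (c b : R) :
  0 <= b -> (forall u, c <= phi u) ->
  (forall u, \sum_(w | E u w) phi w <= b * phi u) ->
  forall n u, c * (nwords_from u n)%:R <= b ^+ n * phi u.
Proof.
move=> b0 cphi sup; elim=> [|n IH] u.
  rewrite mul1r (le_trans _ (cphi u))// /nwords_from card_tuple0//.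
  by rewrite mulr1.
rewrite nwords_fromS natr_sum mulr_sumr exprSr -mulrA.
rewrite (le_trans _ (ler_wpM2l (exprn_ge0 _ b0) (sup u)))// mulr_sumr.
by apply: ler_sum => w _; exact: IH.
Qed.

Lemma nwords_from_lb (R : realType) (psi : W -> R) (c b : R) :
  0 <= b -> (forall u, psi u <= c) ->
  (forall u, b * psi u <= \sum_(w | E u w) psi w) ->
  forall n u, b ^+ n * psi u <= c * (nwords_from u n)%:R.
Proof.
move=> b0 cpsi sub; elim=> [|n IH] u.
  rewrite mul1r (le_trans (cpsi u))// /nwords_from card_tuple0//.
  by rewrite mulr1.
rewrite nwords_fromS natr_sum mulr_sumr exprSr -mulrA.
rewrite (le_trans (ler_wpM2l (exprn_ge0 _ b0) (sub u)))// mulr_sumr.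
by apply: ler_sum => w _; exact: IH.
Qed.

Lemma nwords_ub (R : realType) (phi : W -> R) (b : R) :
  0 < b -> (forall u, 0 < phi u) ->
  (forall u, \sum_(w | E u w) phi w <= b * phi u) ->
  exists2 c : R, 0 < c & forall n, (nwords n)%:R <= c * b ^+ n.
Proof.
move=> b0 phi0 sup.
have [c c0 cphi] : exists2 c : R, 0 < c & forall u, c <= phi u.
  exists (\big[Num.min/1]_u phi u); last by move=> u; exact: bigmin_le_cond.
  by apply: lt_bigmin.
exists (1 + c^-1 * b^-1 * \sum_u phi u) => [|n].
  rewrite ltr_pwDl// mulr_ge0 ?mulr_ge0 ?invr_ge0 ?(ltW c0) ?(ltW b0)//.
  by apply: sumr_ge0 => u _; exact: ltW.
have s0 : 0 <= \sum_u phi u by apply: sumr_ge0 => u _; exact: ltW.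
case: n => [|n].
  rewrite mulr1 /nwords card_tuple0// lerDl.
  by rewrite !mulr_ge0 ?invr_ge0 ?(ltW c0) ?(ltW b0).
rewrite nwordsS; apply: (@le_trans _ _ (c^-1 * (b ^+ n * \sum_u phi u))).
  rewrite ler_pdivlMl// natr_sum !mulr_sumr.
  by apply: ler_sum => u _; exact: nwords_from_ub (ltW b0) cphi sup n u.
have -> : c^-1 * (b ^+ n * \sum_u phi u) =
    c^-1 * b^-1 * (\sum_u phi u) * b ^+ n.+1.
  by rewrite exprS; field; rewrite !gt_eqF.
by rewrite ler_wpM2r ?lerDr// exprn_ge0// ltW.
Qed.

Lemma nwords_lb (R : realType) (psi : W -> R) (b : R) :
  0 < b -> (forall u, 0 < psi u) -> W ->
  (forall u, b * psi u <= \sum_(w | E u w) psi w) ->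
  exists2 c : R, 0 < c & forall n, c * b ^+ n.+1 <= (nwords n.+1)%:R.
Proof.
move=> b0 psi0 u0 sub.
have [c c0 cpsi] : exists2 c : R, 0 < c & forall u, psi u <= c.
  exists (\sum_u psi u) => [|u].
    by rewrite (bigD1 u0)//= ltr_pwDl// sumr_ge0// => u _; exact: ltW.
  by rewrite (bigD1 u)//= lerDl sumr_ge0// => w _; exact: ltW.
exists (psi u0 / (c * b)) => [|n]; first by rewrite divr_gt0// mulr_gt0.
rewrite nwordsS (bigD1 u0)//=.
rewrite (le_trans _ (_ : (nwords_from u0 n)%:R <= _))//; last first.
  by rewrite ler_nat leq_addr.
rewrite mulrAC ler_pdivrMr ?mulr_gt0// exprSr mulrA.
rewrite [leRHS]mulrA ler_pM2r// mulrC [leRHS]mulrC.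
exact: nwords_from_lb (ltW b0) cpsi sub n u0.
Qed.

End word_counts.

(** * Compactness of the space of bi-infinite paths *)

Section markov_topology.
Local Open Scope ring_scope.
Variable H : graph.
Local Notation X := (markov_space H).
Implicit Types (x y : X).

Definition coordinate x (k : int) : H := set_val x k.

Definition agree (m : nat) x y :=
  forall k : int, `|k| <= m%:Z -> coordinate y k = coordinate x k.

Lemma coordinate_arrow x k : arrow (coordinate x k) (coordinate x (k + 1)).
Proof. exact: (set_valP x k). Qed.

Lemma coordinate_shift x k :
  coordinate (markov_shift x) k = coordinate x (k + 1).
Proof. by []. Qed.

Lemma coordinate_iter_shift x k n :
  coordinate (iter n (@markov_shift H) x) k = coordinate x (k + n%:Z).
Proof.
elim: n k => [|n IH] k; first by rewrite addr0.
by rewrite iterS coordinate_shift IH; congr coordinate; lia.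
Qed.

Lemma bi_path_point (f : int -> H) : (forall k, arrow (f k) (f (k + 1))) ->
  exists x, forall k, coordinate x k = f k.
Proof.
move=> fE; have h : (f : {ptws int -> discrete_topology H}) \in bi_paths H.
  exact/mem_set.
by exists (SigSub h).
Qed.

(** The cylinders around [x] generate a filter that converges to [x]
    coordinatewise, hence in the product topology. *)
Lemma open_cylinder (A : set X) x : open A -> A x ->
  exists m, agree m x `<=` A.
Proof.
move=> [B oB <-] Bx.
pose F : set_system {ptws int -> discrete_topology H} :=
  [set C | exists m : nat, forall f,
    (forall k : int, `|k| <= m%:Z -> f k = coordinate x k) -> C f].
have FF : Filter F.
  split.
  - by exists 0%N.
  - move=> C D [m mC] [n nD]; exists (maxn m n) => f fx; split.
      by apply: mC => k km; apply: fx; rewrite (le_trans km)// lez_nat leq_maxl.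
    by apply: nD => k km; apply: fx; rewrite (le_trans km)// lez_nat leq_maxr.
  - by move=> C D CD [m mC]; exists m => f /mC /CD.
have Fx : F --> (set_val x : {ptws int -> discrete_topology H}).
  apply/cvg_sup => k U [V] [[D] oD <-] Dx VU.
  by exists `|k|%N => f fk; apply: VU; rewrite /= fk ?abszE.
have : nbhs (set_val x : {ptws int -> discrete_topology H}) B.
  exact: open_nbhs_nbhs.
move=> /Fx [m mB]; exists m => y xy; exact: mB.
Qed.

Lemma cylinder_open (w : H) : open [set x : X | coordinate x 0 = w].
Proof.
exists [set f : {ptws int -> discrete_topology H} | f 0 = w] => //.
apply: (@open_comp {ptws int -> discrete_topology H} (discrete_topology H)
  (fun f => f 0) [set w]); last exact: discrete_open.
by move=> f _; exact: (@proj_continuous int (fun=> discrete_topology H) 0 f).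
Qed.

Hypothesis H_fin : finite_set [set: H].

(** Sequential compactness through an ultrafilter finer than the cofinite
    filter on the indices: with finitely many vertices each coordinate is
    constant on a large set of indices, and these constants form a bi-infinite
    path because any two of them are realised simultaneously. *)
Lemma markov_compact (f : nat -> X) :
  exists x, forall k, exists2 m, (k <= m)%N & agree k x (f m).
Proof.
have [F [FU Foo]] := ultraFilterLemma (@eventually_filter).
have lim_ex (k : int) : exists w, F [set n | coordinate (f n) k = w].
  apply: contrapT => /forallNP Fn.
  have FC w : F (~` [set n | coordinate (f n) k = w]).
    by case: (in_ultra_setVsetC [set n | coordinate (f n) k = w] FU) => // /Fn.
  have /filter_ex[n] :
      F (\bigcap_(w in [set: H]) ~` [set n | coordinate (f n) k = w]).
    by rewrite -(fset_setK H_fin); apply: filter_bigI => w _; exact: FC.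
  by move=> /(_ (coordinate (f n) k) I); apply.
have [g gF] := choice lim_ex.
have [x xg] : exists x, forall k, coordinate x k = g k.
  apply: bi_path_point => k.
  have [n [<- <-]] := @filter_ex _ F _ _ (filterI (gF k) (gF (k + 1))).
  exact: coordinate_arrow.
exists x => k.
have Fk : F [set n | forall j : int, `|j| <= k%:Z -> coordinate (f n) j = g j].
  elim: (k) => [|m IH].
    apply: filterS (gF 0) => n /= n0 j j0.
    by have -> : j = 0 by lia.
  apply: filterS (filterI IH (filterI (gF m.+1%:Z) (gF (- m.+1%:Z)))).
  move=> n [nm [n1 n2]] j jm.
  have [->|j1] := eqVneq j m.+1%:Z; first exact: n1.
  have [->|j2] := eqVneq j (- m.+1%:Z); first exact: n2.
  by apply: nm; lia.
have Fn : F [set n | (k <= n)%N] by apply: Foo; exists k.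
have [n [kn nk]] := @filter_ex _ F _ _ (filterI Fn Fk).
by exists n => // j jk; rewrite xg nk.
Qed.

(** If for each [m] some cylinder of radius [m] lay in no member of the cover,
    a limit point of the centres would contradict the openness of the member
    that contains it. *)
Lemma markov_lebesgue_number (U : set (set X)) : open_covers X U ->
  exists m, forall x, exists2 A, U A & agree m x `<=` A.
Proof.
move=> [Uo Ucov]; apply: contrapT => /forallNP noL.
have /choice[f fP] (m : nat) : exists x, forall A, U A -> ~ (agree m x `<=` A).
  apply: contrapT => /forallNP nx; apply: (noL m) => x; apply: contrapT => xA.
  by apply: (nx x) => A UA AA; apply: xA; exists A.
have [x xf] := markov_compact f.
have [A UA Ax] : (\bigcup_(A in U) A) x by rewrite Ucov.
have [k kA] := open_cylinder (Uo _ UA) Ax.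
have [m km xfm] := xf k; apply: (fP m A UA) => y fy; apply: kA => j jk.
by rewrite -xfm// fy// (le_trans jk)// lez_nat.
Qed.

End markov_topology.

(** * Topological entropy of finite Markov shifts *)

Section limsup.
Context (R : realType).
Implicit Types (u : (\bar R)^nat) (l : R).

(** An eventual bound suffices in both directions, so that the convergence of
    the entropy sequence is never at stake. *)
Lemma limn_esup_le u l :
  (forall e : R, (0 < e)%R -> \forall n \near \oo, u n <= (l + e)%:E) ->
  limn_esup u <= l%:E.
Proof.
move=> ul; apply/lee_addgt0Pr => e /ul[N _ Nu].
apply: (@le_trans _ _ (ereal_sup (u @` [set n | (N <= n)%N]))).
  by apply: ereal_inf_lbound; exists [set n | (N <= n)%N] => //; exists N.
by apply: ge_ereal_sup => _ [n Nn <-]; exact: Nu.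
Qed.

Lemma limn_esup_ge u l :
  (forall e : R, (0 < e)%R -> \forall n \near \oo, (l - e)%:E <= u n) ->
  l%:E <= limn_esup u.
Proof.
move=> ul; apply: le_ereal_inf_tmp => _ [V [N _ NV] <-].
apply/lee_subgt0Pr => e /ul[M _ Mu].
apply: (@le_trans _ _ (u (maxn N M))); first by apply: Mu; exact: leq_maxr.
by apply: ereal_sup_ubound; exists (maxn N M) => //; apply: NV; exact: leq_maxl.
Qed.

Lemma near_divr_le (K e : R) : (0 < e)%R ->
  \forall n \near \oo, (0 < n)%N /\ (n%:R^-1 * K <= e)%R.
Proof.
move=> e0; near=> n.
have n0 : (0 < n)%N by near: n; exact: nbhs_infty_gt.
split=> //; rewrite mulrC ler_pdivrMr ?ltr0n// -ler_pdivrMl//.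
by near: n; exact: nbhs_infty_ger.
Unshelve. all: by end_near. Qed.

Lemma ln_exp_growth (c b : R) m n : (0 < c)%R -> (0 < b)%R -> (0 < n)%N ->
  (n%:R^-1 * ln (c * b ^+ (n + m)) = ln b + n%:R^-1 * (ln c + m%:R * ln b))%R.
Proof.
move=> c0 b0 n0; rewrite lnM ?posrE ?exprn_gt0// lnXn//.
rewrite -[(ln b *+ _)%R]mulr_natl natrD.
by field; rewrite pnatr_eq0 -lt0n.
Qed.

Lemma growth_le (N : nat -> \bar R) (c b : R) m : (0 < c)%R -> (0 < b)%R ->
  (forall n, 0 <= N n) -> (forall n, N n <= (c * b ^+ (n + m))%:E) ->
  limn_esup (fun n : nat => (n%:R^-1)%:E * lne (N n)) <= (ln b)%:E.
Proof.
move=> c0 b0 N0 Nc; apply: limn_esup_le => e e0.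
apply: filterS (near_divr_le (ln c + m%:R * ln b) e0) => n [n0 ne].
have cb : (0 < c * b ^+ (n + m))%R by rewrite mulr_gt0// exprn_gt0.
apply: (@le_trans _ _ ((n%:R^-1)%:E * lne (c * b ^+ (n + m))%:E)).
  rewrite lee_wpmul2l// ?lee_fin//.
  by rewrite lee_lne// in_itv/= ?leey ?N0//= lee_fin ltW.
by rewrite lne_EFin// -EFinM lee_fin ln_exp_growth// lerD2l.
Qed.

Lemma growth_ge (N : nat -> \bar R) (c b : R) : (0 < c)%R -> (0 < b)%R ->
  (forall n, (c * b ^+ n.+1)%:E <= N n.+1) ->
  (ln b)%:E <= limn_esup (fun n : nat => (n%:R^-1)%:E * lne (N n)).
Proof.
move=> c0 b0 Nc; apply: limn_esup_ge => e e0.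
apply: filterS (near_divr_le (- ln c) e0) => -[[]//|n] [n0 ne].
have cb : (0 < c * b ^+ n.+1)%R by rewrite mulr_gt0// exprn_gt0.
apply: (@le_trans _ _ ((n.+1%:R^-1)%:E * lne (c * b ^+ n.+1)%:E)); last first.
  rewrite lee_wpmul2l// ?lee_fin//.
  rewrite lee_lne// in_itv/= leey ?andbT ?lee_fin ?(ltW cb)//.
  by rewrite (le_trans _ (Nc n))// lee_fin ltW.
rewrite lne_EFin// -EFinM lee_fin -[X in ln (_ * _ ^+ X)]addn0 ln_exp_growth//.
by rewrite mul0r addr0 lerD2l lerNl -mulrN.
Qed.

End limsup.

Lemma counting_image_le (R : realType) (F : finType) (T : choiceType)
    (P : pred F) (f : F -> T) :
  counting (f @` [set t | P t]) <= (#|[pred t | P t]|%:R)%:E :> \bar R.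
Proof.
have fP : finite_set [set t | P t] by exact: finite_finset.
rewrite /counting asboolT; last exact: finite_image.
rewrite lee_fin ler_nat cardE -(size_map f) uniq_leq_size ?fset_uniq// => y.
rewrite in_fset_set; last exact: finite_image.
by rewrite inE => -[t Pt <-]; rewrite map_f// mem_enum.
Qed.

Lemma counting_ge_card (R : realType) (F : finType) (T : choiceType)
    (P : pred F) (V : set T) (f : F -> T) :
  (forall t, P t -> V (f t)) ->
  {in P &, injective f} ->
  (#|[pred t | P t]|%:R)%:E <= counting V :> \bar R.
Proof.
move=> PV finj; rewrite /counting; case: asboolP => [Vf|_]; last exact: leey.
rewrite lee_fin ler_nat cardE -(size_map f) uniq_leq_size//.
  rewrite map_inj_in_uniq ?enum_uniq// => s t.
  by rewrite !mem_enum; exact: finj.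
move=> y /mapP[t]; rewrite mem_enum => Pt ->.
by rewrite in_fset_set// inE; exact: PV.
Qed.

Section markov_entropy.
Context (R : realType).
Variables (W : finType) (E : rel W).
Let H : graph := Graph E.
Local Notation X := (markov_space H).

Let H_fin : finite_set [set: H].
Proof. exact: finite_finset. Qed.

Definition word (x : X) (a : int) n : n.-tuple W :=
  [tuple (coordinate x (a + (val i)%:Z)%R : W) | i < n].

Lemma word_sorted x a n : sorted E (word x a n).
Proof.
case: n => [|n]; first by rewrite tuple0.
apply/(sortedP (coordinate x 0%R : W)) => i; rewrite size_tuple => ni.
rewrite -[i]/(val (Ordinal (ltnW ni))) -[i.+1]/(val (Ordinal ni)).
rewrite -!tnth_nth !tnth_mktuple /= -addn1 PoszD addrA.
exact: (coordinate_arrow x).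
Qed.

Lemma word_coord x y a n (k : int) : word x a n = word y a n ->
  (a <= k)%R -> (k < a + n%:Z)%R -> coordinate x k = coordinate y k.
Proof.
move=> xy ak kn; have kn' : (`|k - a| < n)%N by lia.
have := congr1 (fun t : n.-tuple W => tnth t (Ordinal kn')) xy.
rewrite !tnth_mktuple /=.
by have -> : (a + `|k - a|%N%:Z = k)%R by lia.
Qed.

(** With a Lebesgue number [m], the coordinates from [-m] to [n - 1 + m] of a
    point decide a member of the join that contains it: one member for each
    word of length [n + 2 m] is enough. *)
Lemma markov_subcover_le (U : set (set X)) : open_covers X U ->
  exists m, forall n,
  subcover_number R (iterated_join (@markov_shift H) U n) <=
  (nwords E (n + m))%:R%:E.
Proof.
move=> Uc; have [m mU] := markov_lebesgue_number H_fin Uc.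
exists (m + m)%N => n.
have [[x0 _]|noX] := pselect (exists x : X, True); last first.
  apply: (@le_trans _ _ (counting (set0 : set (set X)))).
    apply: ereal_inf_lbound; exists set0 => //; split=> [//|].
    by apply/seteqP; split => // x; case: noX; exists x.
  by rewrite /counting asboolT// fset_set0 lee_fin.
have /choice[A AP] : forall x : X, exists A, U A /\ agree m x `<=` A.
  by move=> x; have [A UA mA] := mU x; exists A.
pose wd x := word x (- m%:Z)%R (n + (m + m))%N.
(* One point for each word; words that do not occur are sent to [x0]. *)
pose rep t := xget x0 [set x | wd x = t].
pose C x : set X :=
  \bigcap_(i in `I_n)
    (iter i (@markov_shift H) @^-1` A (iter i (@markov_shift H) x)).
apply: le_trans (@counting_image_le R _ _
  (fun t : (n + (m + m)).-tuple W => sorted E t) (C \o rep)).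
apply: ereal_inf_lbound.
exists ((C \o rep) @` [set t : (n + (m + m)).-tuple W | sorted E t]) => //.
split.
  move=> _ [t _ <-] /=.
  exists (fun i => A (iter i (@markov_shift H) (rep t))) => //.
  by move=> i _; exact: (AP _).1.
apply/seteqP; split => // x _; exists (C (rep (wd x))).
  by exists (wd x) => //; exact: word_sorted.
have wr : wd (rep (wd x)) = wd x.
  by apply: (@xgetPex _ x0 [set y | wd y = wd x]); exists x.
move=> i /= ni; apply: (AP _).2 => k km; rewrite !coordinate_iter_shift.
by apply: (word_coord (esym wr)); lia.
Qed.

Lemma markov_entropy_le (c b : R) : (0 < c)%R -> (0 < b)%R ->
  (forall n, (nwords E n)%:R <= c * b ^+ n)%R ->
  topological_entropy R (@markov_shift H) <= (ln b)%:E.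
Proof.
move=> c0 b0 cb; apply: ge_ereal_sup => _ [U Uc <-].
have [m mU] := markov_subcover_le Uc.
apply: (growth_le (c := c) (m := m)) => // n.
  by apply: le_ereal_inf_tmp => _ [V _ <-]; exact: counting_ge0.
by rewrite (le_trans (mU n))// lee_fin.
Qed.

(** A finite path extends to both sides by iterating a choice of successors and
    a choice of predecessors. *)
Lemma sorted_word n (t : n.+1.-tuple W) :
  (forall u, exists w, E u w) -> (forall u, exists w, E w u) -> sorted E t ->
  exists x, word x 0 n.+1 = t.
Proof.
move=> /choice[s sE] /choice[p pE] tE.
pose f (k : int) : H := match k with
  | Posz k => if (k <= n)%N then nth (thead t) t k
              else iter (k - n) s (nth (thead t) t n)
  | Negz k => iter k.+1 p (thead t) end.
have [|x xf] := @bi_path_point H f.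
  have fS (k : nat) : arrow (f k%:Z) (f k.+1%:Z).
    rewrite /f; case: (ltngtP k n) => kn.
    - have /(sortedP (thead t)) := tE; apply; rewrite size_tuple ltnS; lia.
    - by rewrite subSn ?(ltnW kn)//; exact: sE.
    - by rewrite kn subSn// subnn; exact: sE.
  move=> [k|[|k]]; first by rewrite -PoszD addn1.
  - have -> : (Negz 0 + 1 = 0 :> int)%R by [].
    by rewrite /f /= -(tnth_nth _ t ord0) -/(thead t); exact: pE.
  - have -> : (Negz k.+1 + 1 = Negz k :> int)%R by lia.
    exact: pE.
exists x; apply: eq_from_tnth => i; rewrite tnth_mktuple xf add0r /=.
by rewrite -ltnS ltn_ord -tnth_nth.
Qed.

(** For the partition into cylinders of one coordinate, the members of the join
    are the cylinders of words. They are pairwise disjoint, so a subcover needs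
    one for each word that occurs in a bi-infinite path. *)
Lemma markov_entropy_ge (c b : R) : (0 < c)%R -> (0 < b)%R ->
  (forall u, exists w, E u w) -> (forall u, exists w, E w u) ->
  (forall n, c * b ^+ n.+1 <= (nwords E n.+1)%:R)%R ->
  (ln b)%:E <= topological_entropy R (@markov_shift H).
Proof.
move=> c0 b0 sE pE cb.
pose cyl (w : H) := [set x : X | coordinate x 0%R = w].
pose U := [set cyl w | w in [set: H]].
have Uc : open_covers X U.
  split; first by move=> _ [w _ <-]; exact: cylinder_open.
  apply/seteqP; split => // x _; exists (cyl (coordinate x 0%R)) => //.
  by exists (coordinate x 0%R).
apply: (@le_trans _ _ (cover_entropy R (@markov_shift H) U)); last first.
  by apply: ereal_sup_ubound; exists U.
apply: (growth_ge (c := c)) => // n.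
apply: (@le_trans _ _ (nwords E n.+1)%:R%:E); first by rewrite lee_fin.
apply: le_ereal_inf_tmp => _ [V [VU Vcov] <-].
have /choice[f fP] (t : n.+1.-tuple W) : exists A : set X,
    sorted E t -> V A /\ exists x, word x 0 n.+1 = t /\ A x.
  have [tE|//] := boolP (sorted E t); last by exists set0.
  have [x xt] := sorted_word sE pE tE.
  have [A VA Ax] : (\bigcup_(A in V) A) x by rewrite Vcov.
  by exists A => _; split => //; exists x.
apply: (@counting_ge_card R _ _ (fun t : _.-tuple W => sorted E t) V f) =>
  [t /fP[]//|t t' tE t'E tt'].
have [Vt [x [xt ftx]]] := fP t tE.
have [_ [y [yt fty]]] := fP t' t'E.
have [B BU Bt] := VU _ Vt; rewrite -tt' -Bt in fty; rewrite -Bt in ftx.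
rewrite -xt -yt; apply: eq_from_tnth => i; rewrite !tnth_mktuple add0r.
have [w _ wB] := BU i (ltn_ord i).
have := fty i (ltn_ord i); have := ftx i (ltn_ord i).
by rewrite /= -wB /cyl /= !coordinate_iter_shift add0r => -> ->.
Qed.

End markov_entropy.

(** * Gurevich entropy and classification of loop graphs *)

Section gurevich.
Context (R : realType).

Lemma fset_sum_esum (G : choiceType) (W : {fset G}) (P : pred G) (f : G -> R) :
  (forall w, 0 <= f w)%R ->
  (\sum_(w : W | P (val w)) f (val w))%R%:E =
  \esum_(w in [set w | w \in W /\ P w]) (f w)%:E.
Proof.
move=> f0; rewrite -big_seq_fsetE esum_fset; last 2 first.
- by apply: (sub_finite_set _ (finite_fset W)) => w [].
- by move=> w _; rewrite lee_fin.
rewrite -sumEFin fsbig_mkcond.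
rewrite (_ : \sum_(w \in [set: G]) _ =
    \sum_(w \in [set` W]) if P w then (f w)%:E else 0).
  by rewrite fsbig_finite//= set_fsetK big_mkcond.
rewrite [RHS]fsbig_mkcond; apply: eq_fsbigr => w _; rewrite /patch.
rewrite mem_setE.
have [[wW Pw]|nP] := pselect (w \in W /\ P w).
  by rewrite ifT ?wW ?Pw// inE.
rewrite ifN ?notin_setE//; case: (boolP (w \in W)) => // wW; case: ifP => // Pw.
by case: nP.
Qed.

Lemma gurevich_entropy_le (G : graph) (x : R) (phi : G -> R) :
  (0 < x)%R -> (forall u, 0 < phi u)%R -> superharmonic x phi ->
  gurevich_entropy R G <= (ln x^-1)%:E.
Proof.
move=> x0 phi0 sup; apply: ge_ereal_sup => _ [W [E [EG ->]]].
have [||u|c c0 cE] := @nwords_ub W E R (phi \o val) x^-1.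
- by rewrite invr_gt0.
- by move=> u; exact: phi0.
- rewrite ler_pdivlMl// -lee_fin EFinM; apply: le_trans (sup (val u)).
  rewrite lee_pmul2l ?lte_fin//.
  apply: (@le_trans _ _
      (\sum_(w : W | arrow (val u) (val w)) phi (val w))%R%:E).
    rewrite lee_fin [leLHS]big_mkcond [leRHS]big_mkcond /=.
    apply: ler_sum => w _; case: ifP => [/EG ->//|_].
    by case: ifP => // _; exact: ltW.
  rewrite (fset_sum_esum W (arrow (val u))); last by move=> w; exact: ltW.
  by apply: esum_subset => w [].
by apply: markov_entropy_le cE => //; rewrite invr_gt0.
Qed.

(** On the full subgraph with vertices [W] the subharmonic [psi] makes the
    number of words grow at least like [r ^- n]. It also forces every vertex to
    have a successor, whereas predecessors have to be assumed. *)
Lemma gurevich_entropy_ge (G : graph) (W : {fset G}) (r : R) (psi : G -> R) :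
  (0 < r)%R -> (forall u, 0 < psi u)%R -> W ->
  (forall u, u \in W -> exists2 w, w \in W & arrow w u) ->
  (forall u, u \in W -> (psi u)%:E <=
     r%:E * \esum_(w in [set w | w \in W /\ arrow u w]) (psi w)%:E) ->
  (ln r^-1)%:E <= gurevich_entropy R G.
Proof.
move=> r0 psi0 u0 pred sub; pose E (u w : W) := arrow (val u) (val w).
have subE (u : W) : (r^-1 * psi (val u) <= \sum_(w | E u w) psi (val w))%R.
  rewrite ler_pdivrMl// -lee_fin EFinM.
  rewrite (fset_sum_esum W (arrow (val u))); last by move=> w; exact: ltW.
  exact: sub (valP u).
have [||//|//|c c0 cE] := @nwords_lb W E R (psi \o val) r^-1.
- by rewrite invr_gt0.
- by move=> u; exact: psi0.
apply: (@le_trans _ _ (topological_entropy R (@markov_shift (Graph E)))).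
  apply: markov_entropy_ge cE => //; first by rewrite invr_gt0.
  - move=> u; apply: contrapT => /forallNP nE; have := subE u.
    rewrite big1 => [|w /nE//]; apply/negP; rewrite -ltNge.
    by rewrite mulr_gt0// invr_gt0.
  - move=> u; have [w wW wu] := pred _ (valP u).
    by exists [` wW]%fset.
by apply: ereal_sup_ubound; exists W, E.
Qed.

Variables (I : countType) (d : I -> nat).
Local Notation G := (loop_graph d).
Local Notation base := (base d).
Local Notation pos := (@pos I d).

(** The supremum that defines [loop_gen d r] is exceeded by a finite set [J] of
    loops, and the weight is subharmonic on the subgraph that they form. *)
Lemma loop_gurevich_ge (r : R) : (0 < r)%R -> 1 < loop_gen d r ->
  (ln r^-1)%:E <= gurevich_entropy R G.
Proof.
move=> r0 /ereal_sup_gt[_ [J [finJ _] <-] J1].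
pose A : set G := base |` \bigcup_(i in J) [set pos i k | k in `I_(d i).+1].
have finA : finite_set A.
  rewrite finite_setU; split; first exact: finite_set1.
  by apply: bigcup_finite => // i _; apply: finite_image; exact: finite_II.
have inW u : (u \in fset_set A) = (u \in A) by rewrite in_fset_set.
have baseW : base \in fset_set A by rewrite inW inE; left.
have posW i k : J i -> (k <= d i)%N -> pos i k \in fset_set A.
  by move=> Ji ki; rewrite inW inE; right; exists i => //; exists k.
have psi0 u : (0 < weight r u)%R by rewrite exprn_gt0.
have inv u : u \in fset_set A ->
    u = base \/ exists i k, [/\ J i, (k <= d i)%N & u = pos i k].
  rewrite inW inE => -[->|[i Ji [k ki <-]]]; first by left.
  by right; exists i, k.
have [j Jj] : exists j, J j.
  apply: contrapT => /forallNP nJ; move: J1.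
  have -> : J = set0 by apply/seteqP; split => // j /nJ.
  by rewrite fsbig_set0 lte_fin ltr10.
apply: (gurevich_entropy_ge (W := fset_set A) (psi := weight r)) => //.
- by exists base.
- move=> _ /inv[->|[i [k [Ji ki ->]]]].
    by exists (pos j 0); rewrite ?posW ?arrow_pos_base.
  have [->|kd] := eqVneq k (d i).
    by exists base; rewrite ?arrow_base_pos.
  exists (pos i k.+1); first by rewrite posW// ltn_neqAle kd.
  by rewrite arrow_pos_pos ?eqxx// ltn_neqAle kd.
- have w0 w : 0 <= (weight r w)%:E by rewrite lee_fin ltW.
  move=> _ /inv[->|[i [k [Ji ki ->]]]].
    rewrite (@le_trans _ _ (\esum_(i in J) (r ^+ (d i).+2)%:E))//.
      by rewrite esum_fset// 1?ltW// => i _; rewrite lee_fin exprn_ge0// ltW.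
    rewrite (@le_trans _ _ (r%:E *
        \esum_(w in [set pos i (d i) | i in J]) (weight r w)%:E))//.
      rewrite esum_image => [|i i' _ _ /pos_inj[]//].
      rewrite -esumZl ?(ltW r0)//; apply: le_esum => i _.
      by rewrite weight_pos// -EFinM -exprS.
    rewrite lee_pmul2l ?lte_fin//; apply: esum_subset => _ [i Ji <-].
    by split; [exact: posW|rewrite arrow_base_pos].
  case: k ki => [|k] ki.
    rewrite weight_pos// expr1 -[leLHS]mule1 lee_pmul2l ?lte_fin//.
    apply: esum_ge; exists [set base]; last by rewrite fsbig_set1.
    split=> [|_ ->]; first exact: finite_set1.
    by split; [exact: baseW|rewrite arrow_pos_base].
  rewrite weight_pos// exprS EFinM lee_pmul2l ?lte_fin//.
  apply: esum_ge; exists [set pos i k].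
    split=> [|_ ->]; first exact: finite_set1.
    by split; [rewrite posW// ltnW|rewrite arrow_pos_pos ?eqxx// ltnW].
  by rewrite fsbig_set1 weight_pos// ltnW.
Qed.

Section classification.
Variable x : R.
Hypothesis x_gt0 : (0 < x)%R.
Hypothesis gen_le1 : loop_gen d x <= 1.
Hypothesis gen_gt1 : forall r : R, (x < r)%R -> 1 < loop_gen d r.

Let weight_gt0 u : (0 < weight (d := d) x u)%R.
Proof. exact: exprn_gt0. Qed.

Let weight_sup : superharmonic x (weight (d := d) x).
Proof. exact: weight_superharmonic (ltW x_gt0) gen_le1. Qed.

Lemma loop_gurevich_entropy : gurevich_entropy R G = (- ln x)%:E.
Proof.
apply/eqP; rewrite eq_le; apply/andP; split.
  by rewrite -lnV ?posrE//; exact: gurevich_entropy_le weight_gt0 weight_sup.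
apply/lee_subgt0Pr => e e0.
(* This choice of [r] gives [- ln r = - ln x - e]. *)
have xr : (x < x * expR e)%R by rewrite ltr_pMr// expR_gt1.
apply: le_trans (loop_gurevich_ge (lt_trans x_gt0 xr) (gen_gt1 xr)).
rewrite lnV ?posrE ?mulr_gt0 ?expR_gt0// lnM ?posrE ?expR_gt0// expRK.
by rewrite opprD EFinB.
Qed.

Lemma loop_radius u : convergence_radius R (u : G) u = x%:E.
Proof.
apply/eqP; rewrite eq_le; apply/andP; split.
  apply: radius_le => r xr r0.
  exact: green_infinite (lt_trans x_gt0 xr) (gen_gt1 xr).
exact: superharmonic_radius x_gt0 weight_gt0 weight_sup _ _.
Qed.

Lemma loop_transient : loop_gen d x < 1 -> transient R G.
Proof.
move=> F1 u; rewrite loop_radius; under eq_eseriesr do rewrite -EFin_expe.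
exact: first_gen_transient.
Qed.

Lemma loop_positive_recurrent : loop_gen d x = 1 -> loop_mean d x < +oo ->
  positive_recurrent R G.
Proof.
move=> F1 D u; rewrite loop_radius; split.
  under eq_eseriesr do rewrite -EFin_expe.
  exact: first_gen_recurrent.
under eq_eseriesr do rewrite -EFin_expe.
case: (loop_vertexP u) => [|i k ki]; first exact: mean_gen_base.
exact: mean_gen_pos.
Qed.

End classification.
End gurevich.

(** * Prescribing the numbers of loops of each length *)

Section multiplicities.
Context (R : realType).
Implicit Types (y s : R) (a : nat -> nat).

(** [loop_gen] for [a n] loops of length [p * n], as a function of the [p]-th
    power of the variable. *)
Definition mult_gen a y : \bar R := \sum_(n <oo) ((a n)%:R * y ^+ n)%:E.

Lemma mult_gen_term a y n : (0 <= y)%R ->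
  ((a n)%:R * y ^+ n)%:E <= mult_gen a y.
Proof.
move=> y0; have t0 k : 0 <= ((a k)%:R * y ^+ k)%:E.
  by rewrite lee_fin mulr_ge0// exprn_ge0.
apply: le_trans (nneseries_lim_ge n.+1 _) => //.
by rewrite big_mkord big_ord_recr /= leeDr// sume_ge0.
Qed.

Lemma nneseries_le_partial (f : nat -> R) (M : R) : (forall n, 0 <= f n)%R ->
  (forall n, \sum_(k < n) f k <= M)%R -> \sum_(n <oo) (f n)%:E <= M%:E.
Proof.
move=> f0 fM; apply: lime_le.
  by apply: is_cvg_nneseries => n _ _; rewrite lee_fin.
by apply: nearW => n; rewrite big_mkord sumEFin lee_fin.
Qed.

(** The remainder of the series after [n] terms is
    [(n / (1 - y) + y / (1 - y) ^ 2) * y ^ n]; adding it to the partial sum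
    gives the constant value [K]. *)
Lemma nat_geometric_fin y : (0 < y < 1)%R ->
  \sum_(n <oo) (n%:R * y ^+ n)%:E < +oo.
Proof.
move=> /andP[y0 y1]; have d0 : (1 - y != 0)%R by rewrite subr_eq0 gt_eqF.
pose K : R := (y / (1 - y) ^+ 2)%R.
apply: (@le_lt_trans _ _ K%:E); last exact: ltry.
apply: nneseries_le_partial => [n|n]; first by rewrite mulr_ge0// exprn_ge0// ltW.
have : (\sum_(k < n) k%:R * y ^+ k + (n%:R / (1 - y) + K) * y ^+ n = K)%R.
  elim: n => [|n IH]; first by rewrite big_ord0 /K; ring.
  rewrite big_ord_recr /= -[RHS]IH -addrA; congr (_ + _)%R.
  by rewrite exprS -natr1 /K; field.
have d1 : (0 <= 1 - y)%R by lra.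
have : (0 <= (n%:R / (1 - y) + K) * y ^+ n)%R.
  rewrite mulr_ge0 ?exprn_ge0 ?(ltW y0)// addr_ge0 ?divr_ge0 ?(ltW y0)//.
  exact: exprn_ge0.
lra.
Qed.

(** Every term of positive degree is multiplied at least by [s / y] from [y] to
    [s]. *)
Lemma mult_gen_gt1 a y s : (0 < y)%R -> (y < s)%R ->
  (forall n, (0 < a n)%N -> (0 < n)%N) -> mult_gen a y = 1 -> 1 < mult_gen a s.
Proof.
move=> y0 ys a0 ay.
have s0 : (0 < s)%R by exact: lt_trans ys.
have sy : (1 < s / y)%R by rewrite ltr_pdivlMr// mul1r.
apply: (@lt_le_trans _ _ ((s / y)%:E * mult_gen a y)).
  by rewrite ay mule1 lte_fin.
rewrite /mult_gen -nneseriesZl; last first.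
  by move=> n _; rewrite lee_fin mulr_ge0// exprn_ge0// ltW.
apply: lee_nneseries => [n _|n _].
  by rewrite -EFinM lee_fin !mulr_ge0 ?invr_ge0 ?exprn_ge0// ltW.
rewrite -EFinM lee_fin mulrCA.
case: (posnP (a n)) => [->|/a0]; first by rewrite !mul0r.
case: n => // n _; rewrite ler_wpM2l// exprS mulrA divfK ?gt_eqF// exprS.
by rewrite ler_pM2l// lerXn2r ?nnegrE ?ltW.
Qed.

(** Expansion of 1 in powers of [y], without digits before [N], with the digits
    1 imposed at [N] and [N + 1], and greedy afterwards. The two imposed digits
    are responsible for the period of the graph. *)
Section greedy.
Variables (y : R) (N : nat).
Hypothesis y01 : (0 < y < 1)%R.
Hypothesis yN : (y ^+ N + y ^+ N.+1 <= 1)%R.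

Definition greedy_digit n (r : R) : nat :=
  if (n < N)%N then 0%N else if (n < N.+2)%N then 1%N
  else Num.truncn (r / y ^+ n)%R.

Fixpoint remainder n : R :=
  if n is m.+1 then (remainder m - (greedy_digit m (remainder m))%:R * y ^+ m)%R
  else 1%R.

Definition greedy n := greedy_digit n (remainder n).

Let y0 : (0 < y)%R. Proof. by case/andP: y01. Qed.

Let remainder_early n : (n <= N)%N -> remainder n = 1%R.
Proof.
elim: n => //= n IH nN; rewrite IH ?(ltnW nN)// /greedy_digit nN.
by rewrite mul0r subr0.
Qed.

Let remainder_N2 : remainder N.+2 = (1 - y ^+ N - y ^+ N.+1)%R.
Proof.
rewrite /= remainder_early// /greedy_digit ltnn ltnS leqnSn.
by rewrite ltnNge leqnSn /= ltnS leqnn !mul1r.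
Qed.

Let remainder_late n : (N.+2 <= n)%N -> (0 <= remainder n)%R ->
  (0 <= remainder n.+1 < y ^+ n)%R.
Proof.
move=> Nn r0 /=; rewrite /greedy_digit ltnNge (ltnW (ltnW Nn)) ltnNge Nn /=.
have yn : (0 < y ^+ n)%R by exact: exprn_gt0.
have /andP[t1 t2] := truncn_itv (divr_ge0 r0 (ltW yn)).
rewrite subr_ge0 -ler_pdivlMr// t1 /=.
by move: t2; rewrite ltr_pdivrMr// -natr1 mulrDl mul1r; lra.
Qed.

Let remainder_ge0 n : (0 <= remainder n)%R.
Proof.
have late m : (0 <= remainder (m + N.+2))%R.
  elim: m => [|m IH]; first by rewrite add0n remainder_N2 -addrA -opprD subr_ge0.
  by have /andP[] := remainder_late (leq_addl _ _) IH.
have [nN|] := leqP n N; first by rewrite remainder_early.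
rewrite leq_eqVlt => /predU1P[<-|Nn]; last by rewrite -(subnK Nn).
rewrite /= remainder_early// /greedy_digit ltnn ltnS leqnSn mul1r subr_ge0.
by rewrite exprn_ile1// ltW//; case/andP: y01.
Qed.

(** From [N + 3] on the greedy choice leaves less than one unit of the previous
    power; before, the remainder is at most 1. The constant covers both cases,
    and gives at once the convergence of the expansion and a bound on its
    digits. *)
Let remainder_le n : (remainder n <= y ^- N.+2 * y ^+ n)%R.
Proof.
have y1 : (y <= 1)%R by case/andP: y01 => _ /ltW.
have [Nn|nN] := ltnP N.+2 n; last first.
  rewrite mulrC ler_pdivlMr ?exprn_gt0//.
  apply: (@le_trans _ _ (1 * y ^+ N.+2)%R); last first.
    by rewrite mul1r ler_wiXn2l// ltW.
  rewrite ler_wpM2r ?exprn_ge0 ?(ltW y0)//.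
  have rS m : (remainder m.+1 <= remainder m)%R.
    by rewrite /= gerBl mulr_ge0// exprn_ge0// ltW.
  by elim: (n) => // m; exact: le_trans.
case: n Nn => // n; rewrite ltnS => Nn.
have /andP[_ /ltW/le_trans->//] := remainder_late Nn (remainder_ge0 n).
rewrite [leRHS]mulrC ler_pdivlMr ?exprn_gt0// (exprS y n) mulrC.
rewrite ler_pM2r ?exprn_gt0// exprS ler_piMr ?(ltW y0)//.
by rewrite exprn_ile1// ltW.
Qed.

Let greedy_sum n : (\sum_(k < n) (greedy k)%:R * y ^+ k = 1 - remainder n)%R.
Proof.
elim: n => [|n IH]; first by rewrite big_ord0 subrr.
by rewrite big_ord_recr /= IH /greedy; ring.
Qed.

Lemma greedy_gen : mult_gen greedy y = 1.
Proof.
apply: cvg_lim => //.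
under eq_fun do rewrite big_mkord sumEFin greedy_sum.
apply: cvg_EFin; first exact: nearW.
rewrite -[X in _ --> X](subr0 (1%R : R)).
apply: cvgB; first exact: cvg_cst.
apply: (@squeeze_cvgr _ _ _ _ (fun=> 0%R) (fun n => y ^- N.+2 * y ^+ n)%R).
- by apply: nearW => n; rewrite remainder_ge0 remainder_le.
- exact: cvg_cst.
- rewrite -[X in _ --> X](mulr0 (y ^- N.+2)%R); apply: cvgM; first exact: cvg_cst.
  by apply: cvg_expr; rewrite ger0_norm ?(ltW y0)//; case/andP: y01.
Qed.

Lemma greedy_le n : ((greedy n)%:R <= y ^- N.+2)%R.
Proof.
have yn : (0 < y ^+ n)%R by exact: exprn_gt0.
rewrite -(ler_pM2r yn); apply: le_trans (remainder_le n).
by rewrite -subr_ge0; exact: (remainder_ge0 n.+1).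
Qed.

End greedy.

Lemma greedy_multiplicities y : (0 < y < 1)%R ->
  exists a N, [/\ forall n, (0 < a n)%N -> (1 < n)%N,
    (0 < a N)%N /\ (0 < a N.+1)%N, mult_gen a y = 1 &
    \sum_(n <oo) ((a n)%:R * n%:R * y ^+ n)%:E < +oo].
Proof.
move=> y01; have /andP[y0 y1] := y01.
have [N N2 yN] : exists2 N, (1 < N)%N & (y ^+ N + y ^+ N.+1 <= 1)%R.
  have : \forall n \near \oo, (1 < n)%N /\ (y ^+ n < 2^-1)%R.
    near=> n; split; first by near: n; exact: nbhs_infty_gt.
    near: n.
    have /cvgrPdist_lt/(_ 2^-1%R) : (y ^+ n)%R @[n --> \oo] --> (0 : R)%R.
      by apply: cvg_expr; rewrite ger0_norm// ltW.
    rewrite invr_gt0 ltr0n => /(_ isT); apply: filterS => n.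
    by rewrite sub0r normrN ger0_norm// exprn_ge0// ltW.
  case=> N _ /(_ N (leqnn _)) [N2 yN]; exists N => //.
  have : (y ^+ N.+1 <= y ^+ N)%R by rewrite exprS ler_piMl ?exprn_ge0 ?ltW.
  lra.
exists (greedy y N), N; split.
- move=> n; rewrite /greedy /greedy_digit; have [//|Nn _] := ltnP n N.
  exact: leq_trans N2 Nn.
- have e m : (N <= m < N.+2)%N -> greedy y N m = 1%N.
    by move=> /andP[Nm mN]; rewrite /greedy /greedy_digit ltnNge Nm mN.
  by rewrite !e ?leqnn ?leqnSn ?ltnSn.
- exact: greedy_gen.
- pose C : R := (y ^- N.+2)%R.
  apply: (@le_lt_trans _ _ (C%:E * \sum_(n <oo) (n%:R * y ^+ n)%:E)).
    rewrite -nneseriesZl; last first.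
      by move=> n _; rewrite lee_fin mulr_ge0// exprn_ge0// ltW.
    apply: lee_nneseries => [n _|n _].
      by rewrite lee_fin !mulr_ge0// exprn_ge0// ltW.
    rewrite -EFinM lee_fin -mulrA ler_wpM2r ?greedy_le//.
    by rewrite mulr_ge0// exprn_ge0// ltW.
  rewrite lte_mul_pinfty ?nat_geometric_fin// lee_fin.
  by rewrite invr_ge0 exprn_ge0// ltW.
Unshelve. all: by end_near. Qed.

(** Writing [q ^ n] as the cube of [exp (n e)] with [e = ln q / 3], the
    inequality [1 + t <= exp t] gives a cubic lower bound. *)
Lemma near_quadratic_exp (q c : R) : (1 < q)%R ->
  \forall n \near \oo, (c * (n.+1 * n.+2)%:R < q ^+ n)%R.
Proof.
move=> q1; pose e : R := (ln q / 3)%R.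
have e0 : (0 < e)%R by rewrite divr_gt0// ln_gt0.
have q0 : (0 < q)%R by lra.
near=> n; have n0 : (0 < n)%N by near: n; exact: nbhs_infty_gt.
have -> : (q ^+ n = expR (n%:R * e) ^+ 3)%R.
  rewrite -expRM_natl -{1}(@lnK _ q) ?posrE// -expRM_natl; congr expR.
  by rewrite /e; field.
have ne0 : (0 <= n%:R * e)%R by rewrite mulr_ge0// ltW.
apply: (@lt_le_trans _ _ ((n%:R * e) ^+ 3)%R); last first.
  rewrite lerXn2r ?nnegrE ?expR_ge0//.
  by apply: le_trans (expR_ge1Dx _); rewrite lerDr.
apply: (@le_lt_trans _ _ (`|c| * (6 * n%:R ^+ 2))%R).
  rewrite (le_trans (ler_wpM2r _ (ler_norm c)))// ler_wpM2l//.
  by rewrite -natrX -natrM ler_nat; nia.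
have -> : ((n%:R * e) ^+ 3 = n%:R * e ^+ 3 * n%:R ^+ 2)%R by ring.
rewrite mulrA ltr_pM2r ?exprn_gt0 ?ltr0n// -ltr_pdivrMr ?exprn_gt0//.
by near: n; exact: nbhs_infty_gtr.
Unshelve. all: by end_near. Qed.

(** Rounding [y ^- n / w n] down keeps the sum below that of the [1 / w n],
    which telescopes to at most 1/2. As [w] grows only quadratically, beyond
    [y] some single term already exceeds 1. Since [y ^- 1 / w 1] can be large,
    the case [n = 1] has to be excluded explicitly: loops have length at least
    2, also when [p = 1]. *)
Lemma slow_multiplicities y : (0 < y < 1)%R ->
  exists a N, [/\ forall n, (0 < a n)%N -> (1 < n)%N,
    (0 < a N)%N /\ (0 < a N.+1)%N, mult_gen a y < 1 &
    forall s, (y < s)%R -> 1 < mult_gen a s].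
Proof.
move=> /andP[y0 y1].
pose w n : R := (2 * (n.+1 * n.+2)%:R)%R.
have w0 n : (0 < w n)%R by rewrite mulr_gt0// ltr0n.
pose a n := if (n < 2)%N then 0%N else Num.truncn (y ^- n / w n)%R.
have yw0 n : (0 <= y ^- n / w n)%R.
  by rewrite divr_ge0 ?invr_ge0 ?exprn_ge0 ?ltW.
have aw n : ((a n)%:R * y ^+ n <= (w n)^-1)%R.
  have yn : (0 < y ^+ n)%R by exact: exprn_gt0.
  rewrite -ler_pdivlMr// mulrC /a; case: ifP => _; first exact: yw0.
  by rewrite truncn_le yw0.
have iy : (1 < y^-1)%R by rewrite invf_gt1.
have [N _ Nw] : \forall n \near \oo, (1 < n)%N /\ (w n < y^-1 ^+ n)%R.
  near=> n; split; first by near: n; exact: nbhs_infty_gt.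
  by near: n; exact: near_quadratic_exp.
have aN n : (N <= n)%N -> (0 < a n)%N.
  move=> /Nw[n2 wn]; rewrite /a ifN -?leqNgt// truncn_gt0.
  by rewrite ler_pdivlMr// mul1r -exprVn ltW.
exists a, N; split.
- by move=> n; rewrite /a; have [] := ltnP n 2.
- by split; apply: aN.
- apply: (@le_lt_trans _ _ (2^-1)%:E); last by rewrite lte_fin invf_lt1 ?ltr1n.
  apply: nneseries_le_partial => n.
    by rewrite mulr_ge0// exprn_ge0// ltW.
  apply: (@le_trans _ _ (\sum_(k < n) (w k)^-1)%R); first exact: ler_sum.
  have -> : (\sum_(k < n) (w k)^-1 = 2^-1 * (1 - n.+1%:R^-1) :> R)%R.
    elim: n => [|n IH]; first by rewrite big_ord0 invr1 subrr mulr0.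
    rewrite big_ord_recr /= IH /w natrM -!natr1; field.
    by rewrite !natr1 !pnatr_eq0.
  by rewrite ler_piMr// gerBl invr_ge0.
- move=> s ys; have s0 : (0 < s)%R by exact: lt_trans ys.
  have [s1|s1] := leP s 1%R; last first.
    apply: lt_le_trans (mult_gen_term a N (ltW s0)).
    rewrite lte_fin (@lt_le_trans _ _ (s ^+ N)%R)//.
      by rewrite exprn_egt1//; case: (Nw N (leqnn _)); case: (N).
    by rewrite ler_peMl ?exprn_ge0 ?(ltW s0)// ler1n aN.
  have sy : (1 < s / y)%R by rewrite ltr_pdivlMr// mul1r.
  have [n [Nn wn]] : exists n, (N <= n)%N /\ (2 * w n < (s / y) ^+ n)%R.
    have [M _ Mw] := near_quadratic_exp 4 sy.
    exists (maxn N M); split; first exact: leq_maxl.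
    have := Mw (maxn N M) (leq_maxr _ _); apply: le_lt_trans.
    by rewrite /w mulrA -natrM.
  apply: lt_le_trans (mult_gen_term a n (ltW s0)); rewrite lte_fin.
  have sn : (0 < s ^+ n)%R by exact: exprn_gt0.
  have sn1 : (s ^+ n <= 1)%R by rewrite exprn_ile1// ltW.
  have /andP[_ an] := truncn_itv (yw0 n).
  have aE : Num.truncn (y ^- n / w n)%R = a n.
    by rewrite /a; have [n2 _] := Nw n Nn; rewrite ltnNge n2.
  rewrite aE -(ltr_pM2r sn) -natr1 mulrDl mul1r in an.
  have : (2 < y ^- n / w n * s ^+ n)%R.
    by rewrite mulrAC ltr_pdivlMr// [ltRHS]mulrC -exprVn -exprMn.
  lra.
Unshelve. all: by end_near. Qed.

End multiplicities.

Section multiplicity_graph.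
Context (R : realType).
Variables (a : nat -> nat) (p : nat).
Hypothesis p_gt0 : (0 < p)%N.
Hypothesis a_gt1 : forall n, (0 < a n)%N -> (1 < n)%N.

Definition loop_index : countType := {n : nat & 'I_(a n)}.

(** Shifted by 2 so that the loop has length [p * n]; see [loop_depthE]. *)
Definition loop_depth (i : loop_index) : nat := (p * tag i).-2.

Lemma loop_depthE i : (loop_depth i).+2 = (p * tag i)%N.
Proof.
have := a_gt1 (leq_ltn_trans (leq0n _) (ltn_ord (tagged i))).
rewrite /loop_depth; case: p p_gt0 => // q _; case: (tag i) => [|[|n]] //.
Qed.

Lemma esum_loop_index (f : nat -> R) : (forall n, 0 <= f n)%R ->
  \esum_(i in [set: loop_index]) (f (tag i))%:E =
  \sum_(n <oo) ((a n)%:R * f n)%:E.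
Proof.
move=> f0; have f0E n : 0 <= (f n)%:E by rewrite lee_fin.
pose e (i : loop_index) : nat * nat := (tag i, val (tagged i)).
rewrite nneseries_esumT; last by move=> n; rewrite lee_fin mulr_ge0.
rewrite -(reindex_esum setT (setT `*`` (fun n => `I_(a n))) e
  (fun k => (f k.1)%:E)); last first.
  split.
  - by move=> i _; split => //=; exact: ltn_ord.
  - move=> [n k] [m l] _ _ [/= nm]; move: k l; rewrite nm => k l.
    by move/val_inj ->.
  - by move=> [n k] [_ /= kn]; exists (Tagged (fun n => 'I_(a n)) (Ordinal kn)).
rewrite -(esum_esum (a := fun n (k : nat) => (f n)%:E))//; apply: eq_esum => n _.
rewrite esum_fset; [|exact: finite_II|by []].
by rewrite -fsbig_ord sumEFin sumr_const card_ord mulr_natl.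
Qed.

Lemma loop_gen_mult (z : R) : (0 <= z)%R ->
  @loop_gen loop_index loop_depth R z = mult_gen a (z ^+ p)%R.
Proof.
move=> z0; rewrite /loop_gen; under eq_esum do rewrite loop_depthE exprM.
rewrite (esum_loop_index (f := fun n => ((z ^+ p) ^+ n)%R))// => n.
by rewrite !exprn_ge0.
Qed.

Lemma loop_mean_mult (z : R) : (0 <= z)%R -> loop_mean loop_depth z =
  p%:R%:E * \sum_(n <oo) ((a n)%:R * n%:R * (z ^+ p) ^+ n)%:E.
Proof.
move=> z0; rewrite /loop_mean; under eq_esum do rewrite loop_depthE exprM.
rewrite (esum_loop_index (f := fun n => ((p * n)%:R * (z ^+ p) ^+ n)%R)).
  rewrite -nneseriesZl; last first.
    by move=> n _; rewrite lee_fin !mulr_ge0// !exprn_ge0.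
  by apply: eq_eseriesr => n _; rewrite -EFinM natrM; congr (_%:E); ring.
by move=> n; rewrite mulr_ge0// !exprn_ge0.
Qed.

Lemma multiplicity_period N : (0 < a N)%N -> (0 < a N.+1)%N ->
  has_period (loop_graph loop_depth) p.
Proof.
move=> aN aN1; apply: loop_graph_period => [i|q qd].
  by rewrite loop_depthE dvdn_mulr.
have qN := qd (Tagged (fun n => 'I_(a n)) (Ordinal aN)).
have qN1 := qd (Tagged (fun n => 'I_(a n)) (Ordinal aN1)).
move: qN1; rewrite !loop_depthE /= mulnS dvdn_addl//.
by rewrite -(loop_depthE (Tagged _ (Ordinal aN))).
Qed.

End multiplicity_graph.

Theorem corollary11 (R : realType) (p : nat) (h : R)
  (p_gt0 : (0 < p)%N) (h_gt0 : (0 < h)%R) :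
  exists G G' : graph,
    [/\ strongly_connected G /\ strongly_connected G',
        has_period G p /\ has_period G' p,
        gurevich_entropy R G = h%:E /\ gurevich_entropy R G' = h%:E,
        positive_recurrent R G
      & transient R G'].
Proof.
pose x : R := expR (- h); have x0 : (0 < x)%R by exact: expR_gt0.
have xh : (- ln x = h)%R by rewrite expRK opprK.
have y01 : (0 < x ^+ p < 1)%R.
  by rewrite exprn_gt0//= exprn_ilt1 ?(ltW x0)// -?lt0n// expR_lt1 oppr_lt0.
have yr r : (x < r)%R -> (0 <= r)%R /\ (x ^+ p < r ^+ p)%R.
  move=> xr; have r0 : (0 < r)%R by exact: lt_trans xr.
  by split; [exact: ltW|rewrite ltrXn2r ?nnegrE ?ltW// -lt0n].
have [a [N [a1 [aN aN1] aE aD]]] := greedy_multiplicities y01.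
have [b [M [b1 [bM bM1] bE bs]]] := slow_multiplicities y01.
pose d := loop_depth (a := a) p; pose d' := loop_depth (a := b) p.
have gen1 : loop_gen d x = 1 by rewrite loop_gen_mult// ltW.
have gen1' : loop_gen d' x < 1 by rewrite loop_gen_mult// ltW.
have gt1 r : (x < r)%R -> 1 < loop_gen d r.
  move=> /yr[r0 xr]; rewrite loop_gen_mult//; case/andP: y01 => y0 _.
  by apply: mult_gen_gt1 aE => // n /a1 /ltnW.
have gt1' r : (x < r)%R -> 1 < loop_gen d' r.
  by move=> /yr[r0 xr]; rewrite loop_gen_mult//; exact: bs.
exists (loop_graph d), (loop_graph d'); split.
- by split; exact: loop_graph_connected.
- split; first exact: multiplicity_period aN aN1.
  exact: multiplicity_period bM bM1.
- rewrite -xh; split; apply: loop_gurevich_entropy => //; first by rewrite gen1.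
  exact: ltW.
- apply: (loop_positive_recurrent x0) => //; first by rewrite gen1.
  rewrite loop_mean_mult ?(ltW x0)// lte_mul_pinfty// lee_fin.
- by apply: (loop_transient x0) => //; exact: ltW.
Qed.
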